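(* Let $N\ge1$ be an integer and let $I_N(s)$ be the entire function defined in the context. Then $$I_N'(1)=(-1)^N(N-1)!\,\log(N!).$$
   Context: For an integer $M\ge0$, $T_M(x)=\sum_{k=0}^{M}\frac{x^k}{k!}$. Fix $\delta>0$ so small that the closed disc $|w|\le\delta$ contains no zero of $e^w-T_{N-1}(w)$ other than $w=0$. Let $\gamma$ be the contour consisting of the positive real axis traversed from $+\infty$ to $\delta$, then the circle $|w|=\delta$ traversed counterclockwise (from $\delta$ back to $\delta$), then the positive real axis from $\delta$ to $+\infty$. Define $$I_N(s)=\frac{1}{2\pi i}\int_\gamma \big(e^w-T_{N-1}(w)\big)^{-1}(-w)^{s+N-1}\frac{dw}{w},$$ where $(-w)^{a}=e^{a\log(-w)}$ with $\log(-w)=\log x-i\pi$ on the incoming segment ($w=x>0$), $\log(-w)=\log\delta+i(\varphi-\pi)$ on the circle $w=\delta e^{i\varphi}$, $0\le\varphi\le2\pi$, and $\log(-w)=\log x+i\pi$ on the outgoing segment. $I_N$ is an entire function of $s$, independent of the choice of such $\delta$. *)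

(* Defs.v *)
From Stdlib Require Import Reals Factorial.
From Coquelicot Require Import Coquelicot.
Open Scope R_scope.

Definition Cexp (z : C) : C :=
  (exp (Re z) * cos (Im z), exp (Re z) * sin (Im z)).

(* exp_trunc M x = sum_{k=0}^{M} x^k / k!; note that sum_n has M + 1 terms *)
Definition exp_trunc (M : nat) (x : C) : C :=
  sum_n (fun k : nat => (x ^ k / RtoC (INR (fact k)))%C) M.

(* The integrand of I_N(s) at the point w, where l is the value of log(-w)
   chosen on the piece of the contour that is being traversed: log(-w) is
   multivalued on the contour (the positive real axis is traversed twice). *)
Definition integrand (N : nat) (s w l : C) : C :=
  (/ (Cexp w - exp_trunc (N - 1) w) * Cexp ((s + RtoC (INR N) - 1) * l) / w)%C.

(* C is integrated as a real normed module (a complete one); the type has to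
   be given because C has other canonical structures. *)
Definition incoming (N : nat) (delta : R) (s : C) : C :=
  @RInt_gen C_R_CompleteNormedModule
    (fun x : R => integrand N s (RtoC x) (ln x, - PI))
    (Rbar_locally p_infty) (at_point delta).

Definition circle (N : nat) (delta : R) (s : C) : C :=
  @RInt C_R_CompleteNormedModule
    (fun phi : R =>
       let w := (RtoC delta * Cexp (Ci * RtoC phi))%C in
       (integrand N s w (ln delta, (phi - PI)%R) * (Ci * w))%C)
    0 (2 * PI).

Definition outgoing (N : nat) (delta : R) (s : C) : C :=
  @RInt_gen C_R_CompleteNormedModule
    (fun x : R => integrand N s (RtoC x) (ln x, PI))
    (at_point delta) (Rbar_locally p_infty).

Definition I_N (N : nat) (delta : R) (s : C) : C :=
  (/ (2 * RtoC PI * Ci) *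
   (incoming N delta s + circle N delta s + outgoing N delta s))%C.

(* Main.v *)
Require Import Defs.
From Stdlib Require Import Reals Factorial.
From Coquelicot Require Import Coquelicot.
From Stdlib Require Import Lra Lia.
Open Scope R_scope.

(* Write N = M + 1 and f = e^w - T_M.  Since f' - f = w^M / M!, differentiating under the integral
   sign gives I_N'(1) = (-1)^N M! (1 / 2 pi i) int_gamma log(-w) (f'/f - 1) dw.  The two rays
   differ by the jump 2 pi i of log(-w) and contribute delta - ln f(delta), because ln f(x) - x is
   an antiderivative tending to 0 at infinity.  On the circle put w = e^z, z = r + i t: the
   integrand becomes F(z) = (z - pi i) e^(N z) / f(e^z), which is holomorphic, so that the
   r-derivative of int_0^(2 pi) F dt is -i (F(r + 2 pi i) - F(r)) = 2 pi e^(N r) / f(e^r).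
   This is also the derivative of 2 pi M! (ln N! + ln f(e^r) - e^r), and both functions have the
   same asymptotics as r -> -oo, where e^(N z) / f(e^z) -> N!. *)

(** On the circle f winds N times around 0, so integrating by parts there would call for a branch of
    ln f. In the coordinate z this is avoided: w^N / f(w) is single-valued, 2 pi i-periodic and free
    of the zero of f at 0, and the only factor that is not periodic is z - pi i, whose increment
    over a period is all that the r-derivative sees. Letting r tend to -oo stays inside the disc
    where 0 is the only zero of f. The value ln N! is then a constant of integration, fixed by f(w)
    ~ w^N / N! at 0. For the differentiation in s, put s = 1 + u and l = log(-w): each piece of the
    contour integrates a weight times e^(u l), and |e^(u l) - 1 - u l| <= 2 |u|^2 e^(2 |l|) for |u|
    <= 1. One integrable majorant per piece therefore gives a remainder O(|u|^2), hence the complex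
    derivative at s = 1. At that point the power (-w)^N agrees on the two rays, which is why only
    the logarithm jumps. *)

(** * The complex exponential and moduli *)

Lemma C_eq (a b : C) : Re a = Re b -> Im a = Im b -> a = b.
Proof. destruct a, b; simpl; congruence. Qed.

Lemma Cexp_plus (a b : C) : Cexp (a + b) = (Cexp a * Cexp b)%C.
Proof.
  apply C_eq; unfold Cexp, Re, Im; simpl;
    rewrite exp_plus, ?cos_plus, ?sin_plus; ring.
Qed.

Lemma Cexp_RtoC (x : R) : Cexp (RtoC x) = RtoC (exp x).
Proof.
  apply C_eq; unfold Cexp, RtoC, Re, Im; simpl; rewrite ?cos_0, ?sin_0; ring.
Qed.

Lemma Cmod_Cexp (z : C) : Cmod (Cexp z) = exp (Re z).
Proof.
  unfold Cmod, Cexp; simpl.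
  replace (_ + _) with (Rsqr (exp (Re z)) * (Rsqr (sin (Im z)) + Rsqr (cos (Im z)))).
  2: unfold Rsqr; ring.
  rewrite sin2_cos2, Rmult_1_r, sqrt_Rsqr; auto. left; apply exp_pos.
Qed.

Lemma Cexp_neq_0 (z : C) : Cexp z <> RtoC 0.
Proof.
  intros H. apply (f_equal Cmod) in H. rewrite Cmod_Cexp, Cmod_0 in H.
  generalize (exp_pos (Re z)); lra.
Qed.

Lemma Cexp_INR (n : nat) (z : C) : Cexp (RtoC (INR n) * z) = (Cexp z ^ n)%C.
Proof.
  induction n as [|n IH].
  - simpl. replace (RtoC 0 * z)%C with (RtoC 0) by ring.
    rewrite Cexp_RtoC, exp_0. reflexivity.
  - rewrite S_INR, RtoC_plus, Cpow_S, <- IH, <- Cexp_plus. f_equal. ring.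
Qed.

Lemma Re_le_Cmod (z : C) : Rabs (Re z) <= Cmod z.
Proof. eapply Rle_trans; [apply Rmax_l | apply Rmax_Cmod]. Qed.

Lemma Im_le_Cmod (z : C) : Rabs (Im z) <= Cmod z.
Proof. eapply Rle_trans; [apply Rmax_r | apply Rmax_Cmod]. Qed.

Lemma Cmod_le_Re_Im (z : C) : Cmod z <= Rabs (Re z) + Rabs (Im z).
Proof.
  replace z with (RtoC (Re z) + Ci * RtoC (Im z))%C at 1.
  2: apply C_eq; unfold Re, Im; simpl; ring.
  eapply Rle_trans; [apply Cmod_triangle |].
  rewrite Cmod_mult, !Cmod_R.
  replace (Cmod Ci) with 1; [lra |].
  unfold Cmod; simpl. replace (_ + _) with 1 by ring. now rewrite sqrt_1.
Qed.

Lemma exp_le_compat (x y : R) : x <= y -> exp x <= exp y.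
Proof. intros [H | ->]; [left; now apply exp_increasing | apply Rle_refl]. Qed.

Lemma fact_pos (n : nat) : 0 < INR (fact n).
Proof. apply lt_0_INR, lt_O_fact. Qed.

Lemma Cfact_neq_0 (n : nat) : RtoC (INR (fact n)) <> RtoC 0.
Proof. intros H; apply RtoC_inj in H. generalize (fact_pos n); lra. Qed.

Lemma CINR_S_neq_0 (n : nat) : RtoC (INR (S n)) <> RtoC 0.
Proof. intros H; apply RtoC_inj in H. generalize (pos_INR n); rewrite S_INR in H; lra. Qed.

(** * Derivatives along real curves *)

(** Componentwise, so that real calculus (mean value theorem, antiderivatives, parametric integrals)
    applies to each part. Holomorphy enters only as the chain rule along curves. *)
Definition cderiv (c : R -> C) (t : R) (d : C) : Prop :=
  is_derive (fun x => Re (c x)) t (Re d) /\ is_derive (fun x => Im (c x)) t (Im d).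

Lemma is_derive_eq (f : R -> R) (x l l' : R) :
  is_derive f x l -> l = l' -> is_derive f x l'.
Proof. now intros H <-. Qed.

Lemma cderiv_eq (c : R -> C) (t : R) (d d' : C) :
  cderiv c t d -> d = d' -> cderiv c t d'.
Proof. now intros H <-. Qed.

Lemma cderiv_ext (c c' : R -> C) (t : R) (d : C) :
  (forall x, c x = c' x) -> cderiv c t d -> cderiv c' t d.
Proof.
  intros E [H1 H2]; split; [eapply is_derive_ext, H1 | eapply is_derive_ext, H2];
    intros x; simpl; now rewrite E.
Qed.

Lemma cderiv_const (z : C) (t : R) : cderiv (fun _ => z) t (RtoC 0).
Proof. split; apply (is_derive_const (V := R_NormedModule)). Qed.

Lemma cderiv_plus (a b : R -> C) (t : R) (da db : C) :
  cderiv a t da -> cderiv b t db -> cderiv (fun x => (a x + b x)%C) t (da + db)%C.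
Proof.
  intros [A1 A2] [B1 B2]; split.
  - apply (is_derive_plus _ _ _ _ _ A1 B1).
  - apply (is_derive_plus _ _ _ _ _ A2 B2).
Qed.

Lemma cderiv_minus (a b : R -> C) (t : R) (da db : C) :
  cderiv a t da -> cderiv b t db -> cderiv (fun x => (a x - b x)%C) t (da - db)%C.
Proof.
  intros [A1 A2] [B1 B2]; split.
  - apply (is_derive_minus _ _ _ _ _ A1 B1).
  - apply (is_derive_minus _ _ _ _ _ A2 B2).
Qed.

Lemma is_derive_Rmult (f g : R -> R) (x df dg : R) :
  is_derive f x df -> is_derive g x dg ->
  is_derive (fun y => f y * g y) x (df * g x + f x * dg).
Proof.
  intros F G. apply (is_derive_mult _ _ _ _ _ F G). intros; apply Rmult_comm.
Qed.

Lemma cderiv_mult (a b : R -> C) (t : R) (da db : C) :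
  cderiv a t da -> cderiv b t db ->
  cderiv (fun x => (a x * b x)%C) t (da * b t + a t * db)%C.
Proof.
  intros [A1 A2] [B1 B2]; split.
  - eapply is_derive_eq.
    + apply (is_derive_minus (V := R_NormedModule));
        apply is_derive_Rmult; eassumption.
    + unfold minus, plus, opp, Re, Im; simpl; ring.
  - eapply is_derive_eq.
    + apply (is_derive_plus (V := R_NormedModule));
        apply is_derive_Rmult; eassumption.
    + unfold plus, Re, Im; simpl; ring.
Qed.

Lemma Cnorm2_pos (z : C) : z <> RtoC 0 -> 0 < fst z ^ 2 + snd z ^ 2.
Proof.
  intros H. apply Cmod_gt_0 in H. unfold Cmod in H.
  destruct (Rle_lt_dec (fst z ^ 2 + snd z ^ 2) 0) as [h | h]; auto.
  rewrite sqrt_neg_0 in H; lra.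
Qed.

Lemma cderiv_inv (a : R -> C) (t : R) (da : C) :
  cderiv a t da -> a t <> RtoC 0 ->
  cderiv (fun x => (/ a x)%C) t (- da / (a t * a t))%C.
Proof.
  intros [A1 A2] N. pose proof (Cnorm2_pos _ N) as P.
  assert (D : is_derive (fun x => fst (a x) ^ 2 + snd (a x) ^ 2) t
                (2 * (fst (a t) * Re da + snd (a t) * Im da))).
  { eapply is_derive_eq.
    - apply (is_derive_plus (V := R_NormedModule));
      [eapply is_derive_pow, A1 | eapply is_derive_pow, A2].
    - unfold plus, Re, Im; simpl; ring. }
  assert (I := is_derive_inv _ _ _ D (Rgt_not_eq _ _ P)).
  (* Dividing by [a t * a t] creates the denominator |a t|^4, in expanded form; [field] asks for it
     separately from |a t|^2. *)
  assert (Q : fst (a t * a t)%C ^ 2 + snd (a t * a t)%C ^ 2 <> 0).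
  { replace (_ + _) with ((fst (a t) ^ 2 + snd (a t) ^ 2) ^ 2) by (simpl; ring).
    apply pow_nonzero; lra. }
  split.
  - eapply is_derive_eq; [apply is_derive_Rmult; [exact A1 | exact I] |].
    unfold Cdiv, Cinv, Cmult, Copp, Re, Im in *; cbn [fst snd] in *.
    field; split; [intros E; apply Q; rewrite <- E; ring | lra].
  - eapply is_derive_eq.
    + apply is_derive_Rmult; [| exact I].
      apply (is_derive_opp (V := R_NormedModule)). exact A2.
    + unfold opp; simpl.
      unfold Cdiv, Cinv, Cmult, Copp, Re, Im in *; cbn [fst snd] in *.
      field; split; [intros E; apply Q; rewrite <- E; ring | lra].
Qed.

Lemma cderiv_exp (a : R -> C) (t : R) (da : C) :
  cderiv a t da -> cderiv (fun x => Cexp (a x)) t (da * Cexp (a t))%C.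
Proof.
  intros [A1 A2].
  assert (E : is_derive (fun x => exp (Re (a x))) t (Re da * exp (Re (a t)))).
  { apply (is_derive_comp exp (fun x => Re (a x))); [apply is_derive_exp | exact A1]. }
  split.
  - eapply is_derive_eq.
    + apply is_derive_Rmult; [exact E |].
      apply (is_derive_comp cos (fun x => Im (a x))); [apply is_derive_cos | exact A2].
    + unfold scal; simpl; unfold mult; simpl; unfold Re, Im; simpl. ring.
  - eapply is_derive_eq.
    + apply is_derive_Rmult; [exact E |].
      apply (is_derive_comp sin (fun x => Im (a x))); [apply is_derive_sin | exact A2].
    + unfold scal; simpl; unfold mult; simpl; unfold Re, Im; simpl. ring.
Qed.

Lemma cderiv_real (f : R -> R) (t d : R) :
  is_derive f t d -> cderiv (fun x => RtoC (f x)) t (RtoC d).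
Proof. intros H; split; simpl; [exact H | apply (is_derive_const (V := R_NormedModule))]. Qed.

Lemma cderiv_RtoC (t : R) : cderiv RtoC t (RtoC 1).
Proof. apply (cderiv_real (fun x => x)), (is_derive_id (K := R_AbsRing)). Qed.

Lemma cderiv_ray (w : C) (t : R) : cderiv (fun x => (RtoC x * w)%C) t w.
Proof.
  eapply cderiv_eq.
  - apply cderiv_mult; [apply cderiv_RtoC | apply cderiv_const].
  - cbv beta. ring.
Qed.

(* Apply the real mean value theorem to Re (conj v * h), v = h 1 - h 0. *)
Lemma cderiv_bound (h dh : R -> C) (D : R) :
  (forall t, 0 <= t <= 1 -> cderiv h t (dh t)) ->
  (forall t, 0 <= t <= 1 -> Cmod (dh t) <= D) ->
  Cmod (h 1 - h 0)%C <= D.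
Proof.
  intros Hd HD. set (v := (h 1 - h 0)%C).
  assert (E : forall t, 0 <= t <= 1 -> is_derive
    (fun x => Re (Cconj v * h x)%C) t (Re (Cconj v * dh t)%C)).
  { intros t Ht.
    assert (H : cderiv (fun x => Cconj v * h x)%C t (Cconj v * dh t)%C).
    { eapply cderiv_eq; [apply cderiv_mult; [apply cderiv_const | apply Hd, Ht] |].
      cbv beta. ring. }
    exact (proj1 H). }
  destruct (MVT_gen (fun x => Re (Cconj v * h x)%C) 0 1
              (fun x => Re (Cconj v * dh x)%C)) as [c [Hc Eq]].
  - intros x; rewrite Rmin_left, Rmax_right by lra. intros; apply E; lra.
  - intros x; rewrite Rmin_left, Rmax_right by lra. intros Hx.
    apply continuity_pt_filterlim, (ex_derive_continuous (V := R_NormedModule)).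
    eexists; apply E; lra.
  - rewrite Rmin_left, Rmax_right in Hc by lra.
    assert (Eq2 : Cmod v ^ 2 = Re (Cconj v * dh c)%C).
    { rewrite Rmult_minus_distr_l in Eq; rewrite Rmult_1_r, Rmult_0_r, Rminus_0_r in Eq.
      rewrite <- Eq. unfold Cmod. rewrite pow2_sqrt by nra.
      unfold v, Re; simpl; ring. }
    assert (Cmod v ^ 2 <= Cmod v * D).
    { rewrite Eq2. eapply Rle_trans; [apply Rle_abs |].
      eapply Rle_trans; [apply Re_le_Cmod |].
      rewrite Cmod_mult, Cmod_conj. apply Rmult_le_compat_l; [apply Cmod_ge_0 | auto]. }
    assert (0 <= D) by (eapply Rle_trans; [apply Cmod_ge_0 | apply (HD 0); lra]).
    generalize (Cmod_ge_0 v); intros; nra.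
Qed.

(** * Tails of the exponential series *)

Definition exp_tail (M : nat) (w : C) : C := (Cexp w - exp_trunc M w)%C.

Lemma exp_trunc_S (M : nat) (x : C) :
  exp_trunc (S M) x = (exp_trunc M x + x ^ S M / RtoC (INR (fact (S M))))%C.
Proof. unfold exp_trunc. rewrite sum_Sn. reflexivity. Qed.

Lemma exp_trunc_0 (x : C) : exp_trunc 0 x = RtoC 1.
Proof. unfold exp_trunc. rewrite sum_O. simpl. field. Qed.

Lemma Cpow_fact_S (x : C) (M : nat) :
  (x ^ S M / RtoC (INR (fact (S M))))%C
  = (x * (x ^ M / RtoC (INR (fact M))) * / RtoC (INR (S M)))%C.
Proof.
  rewrite fact_simpl, mult_INR, RtoC_mult, Cpow_S. field.
  split; [apply CINR_S_neq_0 | apply Cfact_neq_0].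
Qed.

(** With the factorial included, differentiation only shifts the index, so the derivatives of a
    truncation telescope. *)
Lemma cderiv_monomial (w : R -> C) (t : R) (dw : C) (M : nat) :
  cderiv w t dw ->
  cderiv (fun x => (w x ^ S M / RtoC (INR (fact (S M))))%C) t
    (dw * (w t ^ M / RtoC (INR (fact M))))%C.
Proof.
  intros H. induction M as [|M IH].
  - eapply cderiv_ext; [| eapply cderiv_eq; [exact H |]].
    + intros x; simpl. field.
    + simpl. field.
  - eapply cderiv_ext; [intros x; symmetry; apply Cpow_fact_S |].
    eapply cderiv_eq.
    + apply cderiv_mult; [apply cderiv_mult; [exact H | exact IH] | apply cderiv_const].
    + cbv beta. rewrite (Cpow_fact_S (w t) M), (S_INR (S M)), RtoC_plus.
      field.
      split; [apply CINR_S_neq_0 | split; [apply Cfact_neq_0 |]].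
      cbv beta. rewrite <- RtoC_plus, <- S_INR. apply CINR_S_neq_0.
Qed.

(** The derivative is T_(M-1), written as T_M minus its last term: this covers M = 0 and makes f' -
    f visible at once. *)
Lemma cderiv_exp_trunc (w : R -> C) (t : R) (dw : C) (M : nat) :
  cderiv w t dw ->
  cderiv (fun x => exp_trunc M (w x)) t
    (dw * (exp_trunc M (w t) - w t ^ M / RtoC (INR (fact M))))%C.
Proof.
  intros H. induction M as [|M IH].
  - eapply cderiv_ext; [intros x; symmetry; apply exp_trunc_0 |].
    eapply cderiv_eq; [apply cderiv_const |].
    rewrite exp_trunc_0. simpl. field.
  - eapply cderiv_ext; [intros x; symmetry; apply exp_trunc_S |].
    eapply cderiv_eq.
    + apply cderiv_plus; [exact IH | apply cderiv_monomial, H].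
    + rewrite exp_trunc_S. ring.
Qed.

Lemma cderiv_exp_tail (w : R -> C) (t : R) (dw : C) (M : nat) :
  cderiv w t dw ->
  cderiv (fun x => exp_tail M (w x)) t
    (dw * (exp_tail M (w t) + w t ^ M / RtoC (INR (fact M))))%C.
Proof.
  intros H. eapply cderiv_eq.
  - apply cderiv_minus; [apply cderiv_exp, H | apply cderiv_exp_trunc, H].
  - unfold exp_tail. ring.
Qed.

Lemma exp_tail_at_0 (M : nat) : exp_tail M (RtoC 0) = RtoC 0.
Proof.
  unfold exp_tail. rewrite Cexp_RtoC, exp_0.
  induction M as [|M IH]; [rewrite exp_trunc_0; ring |].
  rewrite exp_trunc_S, Cpow_S.
  transitivity (RtoC 1 - exp_trunc M (RtoC 0))%C; [| exact IH].
  unfold Cdiv. ring.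
Qed.

Lemma exp_tail_S (M : nat) (w : C) :
  exp_tail M w = (exp_tail (S M) w + w ^ S M / RtoC (INR (fact (S M))))%C.
Proof. unfold exp_tail. rewrite exp_trunc_S. ring. Qed.

Lemma Cmod_RtoC_mult (t : R) (w : C) : 0 <= t <= 1 -> Cmod (RtoC t * w) <= Cmod w.
Proof.
  intros Ht. rewrite Cmod_mult, Cmod_R, Rabs_pos_eq by lra.
  generalize (Cmod_ge_0 w); nra.
Qed.

(** Induction on M along the segment from 0 to w: the derivative of the tail of index M + 1 is the
    tail of index M, and the tail vanishes at 0, so each step gains a factor |w|. The factorial is
    given away. *)
Lemma exp_tail_bound (M : nat) (w : C) :
  Cmod (exp_tail M w) <= Cmod w ^ S M * exp (Cmod w).
Proof.
  revert w; induction M as [|M IH]; intros w.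
  - replace (exp_tail 0 w) with (Cexp (RtoC 1 * w) - Cexp (RtoC 0 * w))%C.
    + apply (cderiv_bound (fun t => Cexp (RtoC t * w)%C)
               (fun t => w * Cexp (RtoC t * w))%C).
      * intros t _. apply cderiv_exp, cderiv_ray.
      * intros t Ht. rewrite Cmod_mult, Cmod_Cexp, pow_1.
        apply Rmult_le_compat_l; [apply Cmod_ge_0 |].
        apply exp_le_compat. eapply Rle_trans; [apply Rle_abs |].
        eapply Rle_trans; [apply Re_le_Cmod | now apply Cmod_RtoC_mult].
    + unfold exp_tail. rewrite exp_trunc_0, Cmult_1_l, Cmult_0_l, Cexp_RtoC, exp_0.
      reflexivity.
  - replace (exp_tail (S M) w) with
      (exp_tail (S M) (RtoC 1 * w) - exp_tail (S M) (RtoC 0 * w))%C.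
    + apply (cderiv_bound (fun t => exp_tail (S M) (RtoC t * w)%C)
               (fun t => w * exp_tail M (RtoC t * w))%C).
      * intros t _. eapply cderiv_eq; [apply cderiv_exp_tail, cderiv_ray |].
        (* The extra monomial in the derivative is exactly the term that turns [exp_tail (S M)] back
           into [exp_tail M]. *)
        now rewrite (exp_tail_S M).
      * intros t Ht. rewrite Cmod_mult, <- tech_pow_Rmult, Rmult_assoc.
        apply Rmult_le_compat_l; [apply Cmod_ge_0 |].
        eapply Rle_trans; [apply IH |].
        generalize (Cmod_RtoC_mult t w Ht); intros L.
        apply Rmult_le_compat; [apply pow_le, Cmod_ge_0 | left; apply exp_pos | |].
        -- apply pow_incr; split; [apply Cmod_ge_0 | exact L].
        -- now apply exp_le_compat.
    + rewrite Cmult_1_l, Cmult_0_l, exp_tail_at_0. ring.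
Qed.

(** * Continuity of complex-valued maps *)

(** The domain is arbitrary because continuity is used in a real parameter, in a complex variable
    and in pairs of reals. *)
Definition ccont {T : UniformSpace} (f : T -> C) (x : T) : Prop :=
  continuous (fun y => Re (f y)) x /\ continuous (fun y => Im (f y)) x.

Lemma ccont_continuous {T : UniformSpace} (f : T -> C) (x : T) :
  ccont f x -> @continuous T C_R_CompleteNormedModule f x.
Proof.
  intros [H1 H2] P HP. unfold filtermap.
  destruct HP as [eps HP].
  apply (filter_imp (fun y => ball (Re (f x)) eps (Re (f y)) /\ ball (Im (f x)) eps (Im (f y)))).
  - intros y [A B]. apply HP. split; assumption.
  - apply filter_and; [apply H1 | apply H2]; apply locally_ball.
Qed.

Lemma ccont_const {T : UniformSpace} (z : C) (x : T) : ccont (fun _ => z) x.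
Proof. split; apply continuous_const. Qed.

Lemma ccont_RtoC {T : UniformSpace} (f : T -> R) (x : T) :
  continuous f x -> ccont (fun y => RtoC (f y)) x.
Proof. intros H; split; [exact H | apply continuous_const]. Qed.

Lemma ccont_plus {T : UniformSpace} (f g : T -> C) (x : T) :
  ccont f x -> ccont g x -> ccont (fun y => f y + g y)%C x.
Proof.
  intros [A1 A2] [B1 B2]; split.
  - apply (continuous_plus _ _ _ A1 B1).
  - apply (continuous_plus _ _ _ A2 B2).
Qed.

Lemma ccont_minus {T : UniformSpace} (f g : T -> C) (x : T) :
  ccont f x -> ccont g x -> ccont (fun y => f y - g y)%C x.
Proof.
  intros [A1 A2] [B1 B2]; split.
  - apply (continuous_minus _ _ _ A1 B1).
  - apply (continuous_minus _ _ _ A2 B2).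
Qed.

Lemma ccont_mult {T : UniformSpace} (f g : T -> C) (x : T) :
  ccont f x -> ccont g x -> ccont (fun y => f y * g y)%C x.
Proof.
  intros [A1 A2] [B1 B2]; split.
  - apply (continuous_minus (V := R_NormedModule)
      (fun y => Re (f y) * Re (g y)) (fun y => Im (f y) * Im (g y)));
      now apply (continuous_mult (K := R_AbsRing)).
  - apply (continuous_plus (V := R_NormedModule)
      (fun y => Re (f y) * Im (g y)) (fun y => Im (f y) * Re (g y)));
      now apply (continuous_mult (K := R_AbsRing)).
Qed.

Lemma ccont_exp {T : UniformSpace} (f : T -> C) (x : T) :
  ccont f x -> ccont (fun y => Cexp (f y)) x.
Proof.
  intros [A1 A2].
  assert (E : continuous (fun y => exp (Re (f y))) x)
    by (apply (continuous_comp (fun y => Re (f y)) exp); [exact A1 | apply continuous_exp]).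
  split.
  - apply (continuous_mult (K := R_AbsRing) _ (fun y => cos (Im (f y)))); [exact E |].
    apply (continuous_comp (fun y => Im (f y)) cos); [exact A2 | apply continuous_cos].
  - apply (continuous_mult (K := R_AbsRing) _ (fun y => sin (Im (f y)))); [exact E |].
    apply (continuous_comp (fun y => Im (f y)) sin); [exact A2 | apply continuous_sin].
Qed.

Lemma ccont_norm_sqr {T : UniformSpace} (f : T -> C) (x : T) :
  ccont f x -> continuous (fun y => fst (f y) ^ 2 + snd (f y) ^ 2) x.
Proof.
  intros [A1 A2].
  apply (continuous_ext (fun y => plus (Re (f y) * Re (f y)) (Im (f y) * Im (f y)))).
  - intros y; unfold plus, Re, Im; simpl; ring.
  - apply (continuous_plus (V := R_NormedModule));
      now apply (continuous_mult (K := R_AbsRing)).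
Qed.

Lemma ccont_inv {T : UniformSpace} (f : T -> C) (x : T) :
  ccont f x -> f x <> RtoC 0 -> ccont (fun y => / f y)%C x.
Proof.
  intros [A1 A2] N. apply Cnorm2_pos in N.
  assert (D : continuous (fun y => / (fst (f y) ^ 2 + snd (f y) ^ 2)) x).
  { apply (continuous_comp (fun y => fst (f y) ^ 2 + snd (f y) ^ 2) Rinv).
    - now apply ccont_norm_sqr.
    - apply continuous_Rinv. lra. }
  split.
  - now apply (continuous_mult (K := R_AbsRing) (fun y => Re (f y))).
  - apply (continuous_mult (K := R_AbsRing) (fun y => - Im (f y))); [| exact D].
    now apply (continuous_opp (V := R_NormedModule)).
Qed.

Lemma ccont_pow {T : UniformSpace} (f : T -> C) (x : T) (n : nat) :
  ccont f x -> ccont (fun y => f y ^ n)%C x.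
Proof.
  intros [A1 A2]. induction n as [|n IH]; [apply ccont_const |].
  destruct IH as [B1 B2]. simpl. split.
  - apply (continuous_minus (V := R_NormedModule)
      (fun y => Re (f y) * Re (f y ^ n)%C) (fun y => Im (f y) * Im (f y ^ n)%C));
      now apply (continuous_mult (K := R_AbsRing)).
  - apply (continuous_plus (V := R_NormedModule)
      (fun y => Re (f y) * Im (f y ^ n)%C) (fun y => Im (f y) * Re (f y ^ n)%C));
      now apply (continuous_mult (K := R_AbsRing)).
Qed.

Lemma ccont_exp_tail {T : UniformSpace} (f : T -> C) (x : T) (M : nat) :
  ccont f x -> ccont (fun y => exp_tail M (f y)) x.
Proof.
  intros H. apply ccont_minus; [now apply ccont_exp |].
  induction M as [|M IH].
  - destruct (ccont_const (T := T) (RtoC 1) x) as [A B].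
    split; [eapply continuous_ext, A | eapply continuous_ext, B];
      intros y; cbv beta; now rewrite exp_trunc_0.
  - assert (K : ccont (fun y => exp_trunc M (f y) +
                  f y ^ S M * / RtoC (INR (fact (S M))))%C x).
    { apply ccont_plus; [exact IH |].
      apply ccont_mult; [now apply ccont_pow | apply ccont_const]. }
    destruct K as [A B].
    split; [eapply continuous_ext, A | eapply continuous_ext, B];
      intros y; cbv beta; now rewrite exp_trunc_S.
Qed.

Lemma cderiv_ccont (c : R -> C) (t : R) (d : C) : cderiv c t d -> ccont c t.
Proof.
  intros [A B]; split; apply (ex_derive_continuous (V := R_NormedModule));
    eexists; eassumption.
Qed.

(** * Integrals of complex-valued functions *)

Notation CV := C_R_CompleteNormedModule.

Lemma Cnorm_eq (z : C) : norm (z : CV) = Cmod z.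
Proof. symmetry. apply Cmod_norm. Qed.

Lemma is_RInt_Re_Im (f : R -> C) (a b : R) (l : C) :
  is_RInt (V := R_NormedModule) (fun x => Re (f x)) a b (Re l) ->
  is_RInt (V := R_NormedModule) (fun x => Im (f x)) a b (Im l) ->
  is_RInt (V := CV) f a b l.
Proof.
  intros H1 H2. destruct l as [u v].
  exact (is_RInt_fct_extend_pair (U := R_NormedModule) (V := R_NormedModule) f a b u v H1 H2).
Qed.

Lemma is_RInt_Re (f : R -> C) (a b : R) (l : C) :
  is_RInt (V := CV) f a b l -> is_RInt (V := R_NormedModule) (fun x => Re (f x)) a b (Re l).
Proof.
  exact (is_RInt_fct_extend_fst (U := R_NormedModule) (V := R_NormedModule) f a b l).
Qed.

Lemma is_RInt_Im (f : R -> C) (a b : R) (l : C) :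
  is_RInt (V := CV) f a b l -> is_RInt (V := R_NormedModule) (fun x => Im (f x)) a b (Im l).
Proof.
  exact (is_RInt_fct_extend_snd (U := R_NormedModule) (V := R_NormedModule) f a b l).
Qed.

(** The scalars of [CV] are real, so a complex factor is handled through real and imaginary
    parts. *)
Lemma is_RInt_Cmult (f : R -> C) (a b : R) (l c : C) :
  is_RInt (V := CV) f a b l -> is_RInt (V := CV) (fun x => c * f x)%C a b (c * l)%C.
Proof.
  intros H. pose proof (is_RInt_Re _ _ _ _ H) as H1. pose proof (is_RInt_Im _ _ _ _ H) as H2.
  apply is_RInt_Re_Im.
  - apply (is_RInt_minus (V := R_NormedModule) (fun x => Re c * Re (f x)) (fun x => Im c * Im (f x)) a b
            (Re c * Re l) (Im c * Im l));
      now apply (is_RInt_scal (V := R_NormedModule)).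
  - apply (is_RInt_plus (V := R_NormedModule) (fun x => Re c * Im (f x)) (fun x => Im c * Re (f x)) a b
            (Re c * Im l) (Im c * Re l));
      now apply (is_RInt_scal (V := R_NormedModule)).
Qed.

Lemma is_RInt_gen_Cmult (Fa Fb : (R -> Prop) -> Prop) {FFa : Filter Fa} {FFb : Filter Fb}
  (f : R -> C) (l c : C) :
  is_RInt_gen (V := CV) f Fa Fb l ->
  is_RInt_gen (V := CV) (fun x => c * f x)%C Fa Fb (c * l)%C.
Proof.
  intros H P HP.
  assert (K : ccont (fun z : CV => (c * z)%C) l).
  { apply (ccont_mult (T := CV) (fun _ => c) (fun z => z)); [apply ccont_const |].
    split; [apply (continuous_fst (U := R_UniformSpace) (V := R_UniformSpace))
           | apply (continuous_snd (U := R_UniformSpace) (V := R_UniformSpace))]. }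
  apply ccont_continuous in K.
  specialize (H _ (K P HP)).
  unfold filtermapi in *. revert H. apply filter_imp.
  intros [a b] [y [Hy Py]]. exists (c * y)%C. split; [| exact Py].
  now apply is_RInt_Cmult.
Qed.

Lemma is_RInt_gen_antideriv (F f : R -> R) (a L : R) :
  (forall x, a <= x -> is_derive F x (f x)) ->
  (forall x, a <= x -> continuous f x) ->
  filterlim F (Rbar_locally p_infty) (locally L) ->
  is_RInt_gen (V := R_NormedModule) f (at_point a) (Rbar_locally p_infty) (L - F a).
Proof.
  intros HF Hf HL P HP.
  assert (C : continuous (fun y => y - F a) L).
  { apply (ex_derive_continuous (V := R_NormedModule)). auto_derive. auto. }
  apply (Filter_prod _ _ _ (fun x => x = a) (fun b => a < b /\ P (F b - F a))).
  - reflexivity.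
  - apply filter_and; [exists a; auto | apply (HL _ (C P HP))].
  - intros x b -> [Hb Pb]. exists (F b - F a). split; [| exact Pb].
    apply (is_RInt_derive F f); simpl; rewrite Rmin_left, Rmax_right by lra;
      intros x Hx; [apply HF | apply Hf]; lra.
Qed.

Lemma is_RInt_gen_inv_sqr (a K : R) : 0 < a ->
  is_RInt_gen (V := R_NormedModule) (fun x => K / x ^ 2) (at_point a) (Rbar_locally p_infty) (K / a).
Proof.
  intros Ha. replace (K / a) with (- K * 0 - - K * / a) by (field; lra).
  apply (is_RInt_gen_antideriv (fun x => - K * / x)).
  - intros x Hx. auto_derive; [lra | field; lra].
  - intros x Hx. apply (ex_derive_continuous (V := R_NormedModule)). auto_derive.
    apply Rgt_not_eq, Rmult_lt_0_compat; lra.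
  - assert (C : continuous (fun y => - K * y) 0).
    { apply (ex_derive_continuous (V := R_NormedModule)). auto_derive. auto. }
    apply (filterlim_comp _ _ _ Rinv _ _ _ _ (filterlim_Rbar_inv p_infty ltac:(discriminate)) C).
Qed.

(** Cauchy criterion: the integral of the majorant over [b, c] is K / b - K / c, so the partial
    integrals beyond b differ by at most K / b. *)
Lemma ex_RInt_gen_inv_sqr_bound (f : R -> C) (a K : R) : 0 < a ->
  (forall x, a <= x -> ccont f x) ->
  (forall x, a <= x -> Cmod (f x) <= K / x ^ 2) ->
  ex_RInt_gen (V := CV) f (at_point a) (Rbar_locally p_infty).
Proof.
  intros Ha Hc HK.
  assert (HK0 : 0 <= K).
  { specialize (HK a (Rle_refl a)). generalize (Cmod_ge_0 (f a)); intros.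
    assert (0 <= K / a ^ 2) by lra.
    replace K with (K / a ^ 2 * a ^ 2) by (field; lra).
    apply Rmult_le_pos; [assumption | apply pow_le; lra]. }
  assert (I : forall b c, a <= b -> b <= c -> ex_RInt (V := CV) f b c).
  { intros b c Hb Hbc. apply ex_RInt_continuous.
    rewrite Rmin_left, Rmax_right by lra.
    intros z Hz. apply ccont_continuous, Hc; lra. }
  assert (B : forall b c, a <= b -> b <= c ->
    Cmod (RInt (V := CV) f a c - RInt (V := CV) f a b)%C <= K / b).
  { intros b c Hb Hbc.
    assert (E : RInt (V := CV) f a c = (RInt (V := CV) f a b + RInt (V := CV) f b c)%C)
      by (symmetry; apply (RInt_Chasles (V := CV) f a b c); apply I; lra).
    assert (E2 : forall x y : C, (x + y - x)%C = y) by (intros; ring).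
    rewrite E, E2, <- Cnorm_eq.
    apply Rle_trans with (minus (- K / c) (- K / b)).
    - apply (norm_RInt_le (V := CV) f (fun x => K / x ^ 2) b c); [lra | | |].
      + intros x Hx. rewrite Cnorm_eq. apply HK; lra.
      + apply RInt_correct, I; lra.
      + apply (is_RInt_derive (fun x => - K / x) (fun x => K / x ^ 2));
          rewrite Rmin_left, Rmax_right by lra; intros x Hx.
        * auto_derive; [lra | field; lra].
        * apply (ex_derive_continuous (V := R_NormedModule)). auto_derive.
          apply Rgt_not_eq, Rmult_lt_0_compat; lra.
    - unfold minus, plus, opp; simpl.
      assert (0 <= K / c) by (apply Rdiv_le_0_compat; lra).
      replace (- K / c + - (- K / b)) with (K / b - K / c) by (field; lra). lra. }
  destruct (proj1 (filterlim_locally_cauchy (U := CV) (F := Rbar_locally p_infty)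
              (fun b => RInt (V := CV) f a b))) as [l Hl].
  (* From m >= K / eps + 1 one gets m eps > K, that is K / m < eps; the maximum with a keeps m in
     the domain of the bounds. *)
  - intros eps. set (m := Rmax a (K / eps + 1)).
    assert (ma : a <= m) by apply Rmax_l.
    assert (mK : K / m < eps).
    { assert (K / eps + 1 <= m) by apply Rmax_r. destruct eps as [e He]; simpl in *.
      apply Rmult_lt_reg_r with m; [lra |].
      replace (K / m * m) with K by (field; lra).
      replace K with (K / e * e) by (field; lra). nra. }
    assert (S : forall u v, m <= u -> u <= v ->
      ball (RInt (V := CV) f a u) eps (RInt (V := CV) f a v)).
    { intros u v Hu Huv. apply (norm_compat1 (V := CV)).
      eapply Rle_lt_trans; [rewrite Cnorm_eq; apply B; lra |].
      eapply Rle_lt_trans; [| exact mK].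
      apply Rmult_le_compat_l; [exact HK0 |]. apply Rinv_le_contravar; lra. }
    exists (fun b => m < b). split; [now exists m |].
    intros u v Hu Hv. destruct (Rle_dec u v).
    + apply S; lra.
    + apply ball_sym, S; lra.
  - exists l. intros P HP.
    apply (Filter_prod _ _ _ (fun x => x = a) (fun b => a < b /\ P (RInt (V := CV) f a b))).
    + reflexivity.
    + apply filter_and; [exists a; auto | apply (Hl P HP)].
    + intros x b -> [Hb Pb]. exists (RInt (V := CV) f a b). split; [| exact Pb].
      apply RInt_correct, I; lra.
Qed.

(** * Differentiation with respect to the exponent *)

Lemma Cexp_quadratic (z : C) :
  Cmod (Cexp z - RtoC 1 - z)%C <= Cmod z ^ 2 * exp (Cmod z).
Proof.
  generalize (exp_tail_bound 1 z). unfold exp_tail. rewrite exp_trunc_S, exp_trunc_0.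
  replace (Cexp z - (RtoC 1 + z ^ 1 / RtoC (INR (fact 1))))%C with (Cexp z - RtoC 1 - z)%C.
  - auto.
  - simpl. field.
Qed.

Lemma sqr_le_exp (y : R) : 0 <= y -> y ^ 2 <= 2 * exp y.
Proof.
  intros H. generalize (exp_ge_taylor y 2 H). simpl. lra.
Qed.

(** The point is to separate |u|^2 from a weight that depends on l alone. In |u l|^2 e^(|u l|), one
    exponential absorbs |l|^2 <= 2 e^|l| and the other bounds e^(|u l|). *)
Lemma Cexp_scaled_quadratic (u l : C) : Cmod u <= 1 ->
  Cmod (Cexp (u * l) - RtoC 1 - u * l)%C <= 2 * Cmod u ^ 2 * exp (2 * Cmod l).
Proof.
  intros Hu. eapply Rle_trans; [apply Cexp_quadratic |].
  rewrite Cmod_mult. generalize (Cmod_ge_0 u) (Cmod_ge_0 l); intros U L.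
  rewrite Rpow_mult_distr.
  replace (2 * Cmod l) with (Cmod l + Cmod l) by ring. rewrite exp_plus.
  replace (2 * Cmod u ^ 2 * _) with (Cmod u ^ 2 * (2 * exp (Cmod l)) * exp (Cmod l)) by ring.
  apply Rmult_le_compat.
  - apply Rmult_le_pos; apply pow2_ge_0.
  - left; apply exp_pos.
  - apply Rmult_le_compat_l; [apply pow2_ge_0 | now apply sqr_le_exp].
  - apply exp_le_compat. nra.
Qed.

(** The remainder A(u) - A(0) - u A1 is the integral of phi (e^(u l) - 1 - u l), so G dominates it
    uniformly in u. General filters let the same lemma serve the improper rays and, with two point
    filters, the circle. *)
Lemma RInt_gen_exp_param (Fa Fb : (R -> Prop) -> Prop)
  {FFa : ProperFilter Fa} {FFb : ProperFilter Fb}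
  (phi l : R -> C) (G : R -> R) (lG : R) (A : C -> C) (A1 : C) :
  filter_prod Fa Fb (fun ab => fst ab <= snd ab) ->
  filter_prod Fa Fb (fun ab => forall x, fst ab <= x <= snd ab ->
    Cmod (phi x) * exp (2 * Cmod (l x)) <= G x) ->
  is_RInt_gen (V := R_NormedModule) G Fa Fb lG ->
  (forall u, Cmod u <= 1 ->
     is_RInt_gen (V := CV) (fun x => phi x * Cexp (u * l x))%C Fa Fb (A u)) ->
  is_RInt_gen (V := CV) (fun x => phi x * l x)%C Fa Fb A1 ->
  forall u, Cmod u <= 1 ->
  Cmod (A u - A (RtoC 0) - u * A1)%C <= 2 * Cmod u ^ 2 * lG.
Proof.
  intros Hle HG IG HA HA1 u Hu.
  assert (H0 : Cmod (RtoC 0) <= 1) by (rewrite Cmod_0; lra).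
  pose proof (is_RInt_gen_minus _ _ _ _
    (is_RInt_gen_minus _ _ _ _ (HA u Hu) (HA _ H0))
    (is_RInt_gen_Cmult _ _ _ _ u HA1)) as I.
  pose proof (is_RInt_gen_scal _ (2 * Cmod u ^ 2) _ IG) as IG2.
  rewrite <- Cnorm_eq.
  refine (RInt_gen_norm (V := CV) _ _ _ _ Hle _ I IG2).
  revert HG. apply filter_imp. intros ab H x Hx. specialize (H x Hx).
  rewrite Cnorm_eq.
  change (Cmod (phi x * Cexp (u * l x) - phi x * Cexp (RtoC 0 * l x) - u * (phi x * l x))%C
          <= 2 * Cmod u ^ 2 * G x).
  rewrite Cmult_0_l, Cexp_RtoC, exp_0.
  replace (_ - _)%C with (phi x * (Cexp (u * l x) - RtoC 1 - u * l x))%C by ring.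
  rewrite Cmod_mult.
  apply Rle_trans with (2 * Cmod u ^ 2 * (Cmod (phi x) * exp (2 * Cmod (l x)))).
  - replace (2 * _ * _) with (Cmod (phi x) * (2 * Cmod u ^ 2 * exp (2 * Cmod (l x)))) by ring.
    apply Rmult_le_compat_l; [apply Cmod_ge_0 | now apply Cexp_scaled_quadratic].
  - apply Rmult_le_compat_l; [| exact H].
    generalize (pow2_ge_0 (Cmod u)); lra.
Qed.

Lemma is_derive_quadratic (F : C -> C) (z L : C) (K : R) :
  (forall u, Cmod u <= 1 -> Cmod (F (z + u) - F z - u * L)%C <= K * Cmod u ^ 2) ->
  @is_derive C_AbsRing C_NormedModule F z L.
Proof.
  intros H. split; [apply is_linear_scal_l |].
  intros x Hx.
  (* Differentiability quantifies over every limit point of the filter [locally z]; the only one is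
     z. *)
  apply (is_filter_lim_locally_unique (V := AbsRing_NormedModule C_AbsRing)) in Hx. subst x.
  intros [eps Heps]. simpl.
  assert (K0 : 0 < 1 + Rabs K) by (generalize (Rabs_pos K); lra).
  (* The bound 1 keeps u in the range of the hypothesis, and 1 + |K| is a positive upper bound of K
     whatever its sign. *)
  assert (D : 0 < Rmin 1 (eps / (1 + Rabs K))).
  { apply Rmin_pos; [lra | now apply Rdiv_lt_0_compat]. }
  exists (mkposreal _ D). intros y Hy.
  change C in y.
  change (Cmod (y - z)%C < Rmin 1 (eps / (1 + Rabs K))) in Hy.
  set (u := (y - z)%C) in *.
  assert (Ey : (y : C) = (z + u)%C) by (unfold u; ring).
  change (Cmod (F y - F z - u * L)%C <= eps * Cmod u). rewrite Ey.
  assert (u1 : Cmod u < 1) by (eapply Rlt_le_trans; [exact Hy | apply Rmin_l]).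
  assert (u2 : Cmod u < eps / (1 + Rabs K)) by (eapply Rlt_le_trans; [exact Hy | apply Rmin_r]).
  eapply Rle_trans; [apply H; lra |].
  generalize (Cmod_ge_0 u) (Rle_abs K); intros U AK.
  assert ((1 + Rabs K) * Cmod u <= eps).
  { replace eps with ((1 + Rabs K) * (eps / (1 + Rabs K))) by (field; lra).
    apply Rmult_le_compat_l; lra. }
  simpl. rewrite Rmult_1_r, <- Rmult_assoc. apply Rmult_le_compat_r; [exact U |]. nra.
Qed.

(** * The two rays *)

(** Written with [sum_f_R0] to match [exp_ge_taylor], the source of all lower bounds on f along the
    rays. *)
Definition rtrunc (M : nat) (x : R) : R := sum_f_R0 (fun k => x ^ k / INR (fact k)) M.
Definition rtail (M : nat) (x : R) : R := exp x - rtrunc M x.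

Lemma exp_trunc_RtoC (M : nat) (x : R) : exp_trunc M (RtoC x) = RtoC (rtrunc M x).
Proof.
  unfold rtrunc. induction M as [|M IH].
  - rewrite exp_trunc_0. simpl. f_equal. field.
  - rewrite exp_trunc_S, IH. cbn [sum_f_R0].
    rewrite RtoC_plus, RtoC_div, RtoC_pow; [reflexivity | apply INR_fact_neq_0].
Qed.

Lemma exp_tail_RtoC (M : nat) (x : R) : exp_tail M (RtoC x) = RtoC (rtail M x).
Proof.
  unfold exp_tail, rtail. now rewrite exp_trunc_RtoC, Cexp_RtoC, RtoC_minus.
Qed.

Lemma monomial_ge_0 (x : R) (k : nat) : 0 <= x -> 0 <= x ^ k / INR (fact k).
Proof. intros H. apply Rdiv_le_0_compat; [now apply pow_le | apply fact_pos]. Qed.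

Lemma rtrunc_ge_0 (M : nat) (x : R) : 0 <= x -> 0 <= rtrunc M x.
Proof. intros H. apply cond_pos_sum. intros k. now apply monomial_ge_0. Qed.

Lemma rtrunc_le (M j : nat) (x : R) : 0 <= x -> rtrunc M x <= rtrunc (M + j) x.
Proof.
  intros H. induction j as [|j IH]; [rewrite Nat.add_0_r; apply Rle_refl |].
  rewrite Nat.add_succ_r. unfold rtrunc in *. cbn [sum_f_R0].
  generalize (monomial_ge_0 x (S (M + j)) H). lra.
Qed.

(** For x >= 0 the tail dominates each of its own terms. The index j selects one: j = 0 gives
    positivity, and j = 3 gives decay of x^M / f(x) like x^(-4). *)
Lemma rtail_lower (M j : nat) (x : R) : 0 <= x ->
  x ^ (S (M + j)) / INR (fact (S (M + j))) <= rtail M x.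
Proof.
  intros H. unfold rtail. generalize (exp_ge_taylor x (S (M + j)) H) (rtrunc_le M j x H).
  unfold rtrunc. cbn [sum_f_R0]. lra.
Qed.

Lemma rtail_pos (M : nat) (x : R) : 0 < x -> 0 < rtail M x.
Proof.
  intros H. eapply Rlt_le_trans; [| apply (rtail_lower M 0); lra].
  apply Rdiv_lt_0_compat; [now apply pow_lt | apply fact_pos].
Qed.

Lemma is_derive_rtail (M : nat) (x : R) :
  is_derive (rtail M) x (rtail M x + x ^ M / INR (fact M)).
Proof.
  destruct (cderiv_exp_tail RtoC x (RtoC 1) M (cderiv_RtoC x)) as [H _].
  rewrite exp_tail_RtoC, <- RtoC_pow, <- RtoC_div, <- RtoC_plus, Cmult_1_l in H
    by apply INR_fact_neq_0.
  eapply is_derive_ext, H. intros t. cbv beta. now rewrite exp_tail_RtoC.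
Qed.

(** Termwise, x times x^k / k! is k + 1 times the next term, and k + 1 <= M + 1. Together with
    T_(M+1) <= e^x this yields T_M(x) e^(-x) <= (M + 1) / x. *)
Lemma rtrunc_mult_le (M : nat) (x : R) : 0 <= x -> rtrunc M x * x <= INR (S M) * rtrunc (S M) x.
Proof.
  intros H. induction M as [|M IH].
  - unfold rtrunc. simpl. lra.
  - replace (rtrunc (S M) x) with (rtrunc M x + x ^ S M / INR (fact (S M))) at 1 by reflexivity.
    replace (rtrunc (S (S M)) x) with (rtrunc (S M) x + x ^ S (S M) / INR (fact (S (S M))))
      by reflexivity.
    replace (x ^ S (S M) / INR (fact (S (S M))))
      with (x ^ S M / INR (fact (S M)) * x / INR (S (S M))).
    2: { rewrite (fact_simpl (S M)), mult_INR. simpl pow. field.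
         repeat split; first [apply INR_fact_neq_0 | apply not_0_INR; lia]. }
    rewrite Rmult_plus_distr_r, Rmult_plus_distr_l.
    apply Rplus_le_compat.
    + eapply Rle_trans; [exact IH |]. apply Rmult_le_compat_r; [now apply rtrunc_ge_0 |].
      apply le_INR; lia.
    + right. field. split; [apply INR_fact_neq_0 | apply not_0_INR; lia].
Qed.

(** The function equals ln (1 - T_M(x) e^(-x)), and T_M(x) e^(-x) tends to 0. *)
Lemma ln_rtail_asymptotic (M : nat) :
  filterlim (fun x => ln (rtail M x) - x) (Rbar_locally p_infty) (locally 0).
Proof.
  assert (L : filterlim (fun x => rtrunc M x * exp (- x)) (Rbar_locally p_infty) (locally 0)).
  { apply (is_lim_le_le_loc (fun _ => 0) (fun x => INR (S M) * / x)
             (fun x => rtrunc M x * exp (- x)) p_infty 0).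
    - exists 0. intros x Hx. split.
      + apply Rmult_le_pos; [apply rtrunc_ge_0; lra | left; apply exp_pos].
      + rewrite exp_Ropp. generalize (exp_pos x); intros E.
        apply Rmult_le_reg_r with (x * exp x); [now apply Rmult_lt_0_compat |].
        replace (rtrunc M x * / exp x * (x * exp x)) with (rtrunc M x * x) by (field; lra).
        replace (INR (S M) * / x * (x * exp x)) with (INR (S M) * exp x) by (field; lra).
        eapply Rle_trans; [apply rtrunc_mult_le; lra |].
        apply Rmult_le_compat_l; [apply pos_INR |]. apply exp_ge_taylor; lra.
    - apply is_lim_const.
    - replace (Finite 0) with (Rbar_mult (INR (S M)) (Rbar_inv p_infty))
        by (simpl; now rewrite Rmult_0_r).
      apply is_lim_scal_l. apply (filterlim_Rbar_inv p_infty). discriminate. }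
  assert (C : continuous (fun y => ln (1 - y)) 0).
  { apply (ex_derive_continuous (V := R_NormedModule)). auto_derive. lra. }
  unfold continuous in C. rewrite Rminus_0_r, ln_1 in C.
  generalize (filterlim_comp _ _ _ _ _ _ _ _ L C). apply filterlim_ext_loc.
  exists 0. intros x Hx.
  replace (1 - rtrunc M x * exp (- x)) with (rtail M x * exp (- x)).
  - rewrite ln_mult, ln_exp; [reflexivity | now apply rtail_pos | apply exp_pos].
  - unfold rtail. rewrite exp_Ropp. field. apply Rgt_not_eq, exp_pos.
Qed.

(** Here x^M / f = M! (f'/f - 1), whose antiderivative M! (ln f(x) - x) vanishes at infinity. *)
Lemma is_RInt_gen_inv_rtail (M : nat) (a : R) : 0 < a ->
  is_RInt_gen (V := R_NormedModule) (fun x => x ^ M / rtail M x) (at_point a) (Rbar_locally p_infty)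
    (INR (fact M) * (a - ln (rtail M a))).
Proof.
  intros Ha. pose proof (fact_pos M) as F.
  replace (INR (fact M) * (a - ln (rtail M a)))
    with (INR (fact M) * 0 - INR (fact M) * (ln (rtail M a) - a)) by ring.
  apply (is_RInt_gen_antideriv (fun x => INR (fact M) * (ln (rtail M x) - x))).
  - intros x Hx. assert (P : 0 < rtail M x) by (apply rtail_pos; lra).
    pose proof (is_derive_rtail M x) as D.
    auto_derive.
    + split; [eexists; exact D | auto].
    + replace (Derive (fun y => rtail M y) x) with (rtail M x + x ^ M / INR (fact M))
        by (symmetry; apply is_derive_unique, D).
      field. lra.
  - intros x Hx. assert (P : 0 < rtail M x) by (apply rtail_pos; lra).
    apply (ex_derive_continuous (V := R_NormedModule)).
    auto_derive. split; [eexists; apply is_derive_rtail | split; [lra | auto]].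
  - assert (C : continuous (fun y => INR (fact M) * y) 0).
    { apply (ex_derive_continuous (V := R_NormedModule)). auto_derive. auto. }
    exact (filterlim_comp _ _ _ _ _ _ _ _ (ln_rtail_asymptotic M) C).
Qed.

(** * The integrand on a ray and its integrable majorant *)

Definition ray_log (theta x : R) : C := (ln x, theta).

(** The integrand at s = 1, with N = M + 1 and theta = PI or - PI; at s = 1 + u it acquires the
    factor [Cexp (u * ray_log theta x)]. *)
Definition ray_weight (M : nat) (theta x : R) : C :=
  (/ exp_tail M (RtoC x) * Cexp (RtoC (INR (S M)) * ray_log theta x) / RtoC x)%C.

Lemma RtoC_neq_0 (x : R) : x <> 0 -> RtoC x <> RtoC 0.
Proof. intros H E. apply H. now apply RtoC_inj. Qed.

Lemma ccont_ray_log (theta x : R) : 0 < x -> ccont (ray_log theta) x.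
Proof.
  intros H. split; [| apply continuous_const].
  apply (ex_derive_continuous (V := R_NormedModule) ln). auto_derive. exact H.
Qed.

Lemma ccont_ray_weight (M : nat) (theta x : R) : 0 < x -> ccont (ray_weight M theta) x.
Proof.
  intros H. unfold ray_weight.
  assert (I : ccont (fun y : R_UniformSpace => RtoC y) x)
    by apply ccont_RtoC, continuous_id.
  apply (ccont_mult (fun x => / exp_tail M (RtoC x) * Cexp (RtoC (INR (S M)) * ray_log theta x))%C
           (fun x => / RtoC x)%C).
  - apply ccont_mult.
    + apply ccont_inv; [now apply ccont_exp_tail |].
      rewrite exp_tail_RtoC. now apply RtoC_neq_0, Rgt_not_eq, rtail_pos.
    + apply ccont_exp, ccont_mult; [apply ccont_const | now apply ccont_ray_log].
  - apply ccont_inv; [exact I | apply RtoC_neq_0; lra].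
Qed.

Lemma Cmod_ray_weight (M : nat) (theta x : R) : 0 < x ->
  Cmod (ray_weight M theta x) = x ^ M / rtail M x.
Proof.
  intros H. unfold ray_weight, Cdiv. pose proof (rtail_pos M x H) as P.
  rewrite exp_tail_RtoC, !Cmod_mult, !Cmod_inv, !Cmod_R, !Rabs_pos_eq
    by (try apply RtoC_neq_0; lra).
  rewrite Cexp_INR, Cmod_pow, Cmod_Cexp. simpl. rewrite exp_ln by exact H. field. lra.
Qed.

(** The left side is the larger of x^2 and x^(-2), and x^(-2) <= x^2 / d^4 because d <= x. *)
Lemma exp_2_ln_le (d x : R) : 0 < d -> d <= x ->
  exp (2 * Rabs (ln x)) <= x ^ 2 * (1 + / d ^ 4).
Proof.
  intros Hd Hx. assert (D : 0 < d ^ 4) by (apply pow_lt; lra).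
  assert (X : 0 < x ^ 2) by (apply pow_lt; lra).
  assert (E : exp (2 * ln x) = x ^ 2).
  { replace (2 * ln x) with (ln x + ln x) by ring. rewrite exp_plus, exp_ln by lra. ring. }
  assert (I : 0 < / d ^ 4) by now apply Rinv_0_lt_compat.
  unfold Rabs. destruct (Rcase_abs (ln x)).
  - rewrite Ropp_mult_distr_r_reverse, exp_Ropp, E.
    apply Rle_trans with (x ^ 2 * / d ^ 4); [| nra].
    apply Rmult_le_reg_r with (d ^ 4 * x ^ 2); [now apply Rmult_lt_0_compat |].
    replace (/ x ^ 2 * (d ^ 4 * x ^ 2)) with (d ^ 4) by (field; lra).
    replace (x ^ 2 * / d ^ 4 * (d ^ 4 * x ^ 2)) with (x ^ 4) by (field; lra).
    apply pow_incr; lra.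
  - rewrite E. nra.
Qed.

Lemma ray_bound (M : nat) (d : R) : 0 < d -> exists K, forall theta x,
  Rabs theta <= PI -> d <= x ->
  Cmod (ray_weight M theta x) * exp (2 * Cmod (ray_log theta x)) <= K / x ^ 2.
Proof.
  (* The factor (M + 4)! comes from |weight| <= (M + 4)! / x^4, and the other factors from e^(2 |l|)
     <= e^(2 pi) x^2 (1 + 1 / d^4), where |l| <= |ln x| + pi. *)
  intros Hd. exists (INR (fact (S (M + 3))) * (exp (2 * PI) * (1 + / d ^ 4))).
  intros theta x Ht Hx. assert (X : 0 < x) by lra.
  pose proof (rtail_pos M x X) as P. pose proof (fact_pos (S (M + 3))) as F.
  rewrite Cmod_ray_weight by exact X.
  assert (B1 : x ^ M / rtail M x <= INR (fact (S (M + 3))) / x ^ 4).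
  { assert (L := rtail_lower M 3 x (Rlt_le _ _ X)).
    apply Rmult_le_reg_r with (rtail M x * x ^ 4);
      [apply Rmult_lt_0_compat; [exact P | now apply pow_lt] |].
    replace (x ^ M / rtail M x * (rtail M x * x ^ 4)) with (x ^ S (M + 3)).
    2: { replace (S (M + 3)) with (M + 4)%nat by lia. rewrite pow_add. field. lra. }
    replace (INR (fact (S (M + 3))) / x ^ 4 * (rtail M x * x ^ 4))
      with (INR (fact (S (M + 3))) * rtail M x) by (field; lra).
    apply Rmult_le_reg_l with (/ INR (fact (S (M + 3)))); [now apply Rinv_0_lt_compat |].
    rewrite <- Rmult_assoc, Rinv_l, Rmult_1_l by lra.
    rewrite Rmult_comm. exact L. }
  assert (B2 : exp (2 * Cmod (ray_log theta x)) <= exp (2 * PI) * (x ^ 2 * (1 + / d ^ 4))).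
  { apply Rle_trans with (exp (2 * PI) * exp (2 * Rabs (ln x))).
    - rewrite <- exp_plus. apply exp_le_compat.
      generalize (Cmod_le_Re_Im (ray_log theta x)). simpl. lra.
    - apply Rmult_le_compat_l; [left; apply exp_pos | now apply exp_2_ln_le]. }
  eapply Rle_trans.
  - apply Rmult_le_compat; [| left; apply exp_pos | exact B1 | exact B2].
    apply Rdiv_le_0_compat; [apply pow_le; lra | exact P].
  - right. field. lra.
Qed.

(** Meant for g = e^(u l) with |u| <= 1 and for g = l; both stay below e^(2 |l|), the weight
    controlled by [ray_bound]. *)
Lemma ex_RInt_gen_ray (M : nat) (d theta : R) (g : R -> C) :
  0 < d -> Rabs theta <= PI ->
  (forall x, d <= x -> ccont g x) ->
  (forall x, d <= x -> Cmod (g x) <= exp (2 * Cmod (ray_log theta x))) ->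
  ex_RInt_gen (V := CV) (fun x => ray_weight M theta x * g x)%C (at_point d) (Rbar_locally p_infty).
Proof.
  intros Hd Ht Hc Hg. destruct (ray_bound M d Hd) as [K HK].
  apply (ex_RInt_gen_inv_sqr_bound _ d K Hd).
  - intros x Hx. apply ccont_mult; [apply ccont_ray_weight; lra | now apply Hc].
  - intros x Hx. eapply Rle_trans; [| now apply (HK theta)].
    rewrite Cmod_mult. apply Rmult_le_compat_l; [apply Cmod_ge_0 | now apply Hg].
Qed.

Lemma ex_RInt_gen_ray_exp (M : nat) (d theta : R) (u : C) :
  0 < d -> Rabs theta <= PI -> Cmod u <= 1 ->
  ex_RInt_gen (V := CV) (fun x => ray_weight M theta x * Cexp (u * ray_log theta x))%C
    (at_point d) (Rbar_locally p_infty).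
Proof.
  intros Hd Ht Hu. apply ex_RInt_gen_ray; auto.
  - intros x Hx. apply ccont_exp, ccont_mult; [apply ccont_const | apply ccont_ray_log; lra].
  - intros x Hx. rewrite Cmod_Cexp. apply exp_le_compat.
    eapply Rle_trans; [apply Rle_abs |]. eapply Rle_trans; [apply Re_le_Cmod |].
    rewrite Cmod_mult. generalize (Cmod_ge_0 (ray_log theta x)); nra.
Qed.

Lemma ex_RInt_gen_ray_log (M : nat) (d theta : R) :
  0 < d -> Rabs theta <= PI ->
  ex_RInt_gen (V := CV) (fun x => ray_weight M theta x * ray_log theta x)%C
    (at_point d) (Rbar_locally p_infty).
Proof.
  intros Hd Ht. apply ex_RInt_gen_ray; auto.
  - intros x Hx. apply ccont_ray_log; lra.
  - intros x Hx. generalize (Cmod_ge_0 (ray_log theta x)); intros L.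
    generalize (exp_ineq1_le (2 * Cmod (ray_log theta x))). lra.
Qed.

Lemma ray_derivative (M : nat) (d theta : R) : 0 < d -> Rabs theta <= PI ->
  exists (A : C -> C) (A1 : C) (K : R),
    (forall u, Cmod u <= 1 -> is_RInt_gen (V := CV)
      (fun x => ray_weight M theta x * Cexp (u * ray_log theta x))%C
      (at_point d) (Rbar_locally p_infty) (A u)) /\
    is_RInt_gen (V := CV) (fun x => ray_weight M theta x * ray_log theta x)%C
      (at_point d) (Rbar_locally p_infty) A1 /\
    (forall u, Cmod u <= 1 -> Cmod (A u - A (RtoC 0) - u * A1)%C <= K * Cmod u ^ 2).
Proof.
  intros Hd Ht. destruct (ray_bound M d Hd) as [K HK].
  set (A := fun u => RInt_gen (V := CV) (fun x => ray_weight M theta x * Cexp (u * ray_log theta x))%C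
      (at_point d) (Rbar_locally p_infty)).
  assert (HA : forall u, Cmod u <= 1 -> is_RInt_gen (V := CV)
      (fun x => ray_weight M theta x * Cexp (u * ray_log theta x))%C
      (at_point d) (Rbar_locally p_infty) (A u)).
  { intros u Hu. apply (RInt_gen_correct (V := CV)), ex_RInt_gen_ray_exp; auto. }
  destruct (ex_RInt_gen_ray_log M d theta Hd Ht) as [A1 HA1].
  (* K / d is the integral of the majorant K / x^2 from d to infinity. *)
  exists A, A1, (2 * (K / d)). split; [exact HA | split; [exact HA1 |]].
  intros u Hu. replace (2 * (K / d) * Cmod u ^ 2) with (2 * Cmod u ^ 2 * (K / d)) by ring.
  refine (RInt_gen_exp_param _ _ _ _ _ _ A A1 _ _ (is_RInt_gen_inv_sqr d K Hd) HA HA1 u Hu).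
  - apply (Filter_prod _ _ _ (fun x => x = d) (fun b => d < b)).
    + reflexivity.
    + now exists d.
    + intros x y -> Hy. simpl; lra.
  - apply (Filter_prod _ _ _ (fun x => x = d) (fun b => d < b)).
    + reflexivity.
    + now exists d.
    + intros x y -> Hy z Hz. simpl in Hz. apply HK; [exact Ht | lra].
Qed.

(** For either angle e^l = -x, and N is an integer, so the weight does not depend on the side of the
    cut. *)
Lemma ray_weight_PI (M : nat) (theta x : R) : 0 < x -> theta = PI \/ theta = - PI ->
  ray_weight M theta x = RtoC ((-1) ^ S M * (x ^ M / rtail M x)).
Proof.
  intros H Ht. pose proof (rtail_pos M x H) as P. unfold ray_weight.
  assert (E : Cexp (ray_log theta x) = RtoC (- 1 * x)).
  { unfold Cexp, ray_log; simpl. rewrite exp_ln by exact H.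
    destruct Ht as [-> | ->]; rewrite ?cos_neg, ?sin_neg, cos_PI, sin_PI;
    apply C_eq; simpl; ring. }
  rewrite Cexp_INR, E, exp_tail_RtoC, <- RtoC_pow, Rpow_mult_distr.
  rewrite <- RtoC_inv, <- RtoC_mult, <- RtoC_div by lra.
  f_equal. simpl. field. lra.
Qed.

Lemma is_RInt_gen_RtoC (Fa Fb : (R -> Prop) -> Prop) {FFa : Filter Fa} {FFb : Filter Fb}
  (f : R -> R) (l : R) :
  is_RInt_gen (V := R_NormedModule) f Fa Fb l ->
  is_RInt_gen (V := CV) (fun x => RtoC (f x)) Fa Fb (RtoC l).
Proof.
  intros H P HP.
  assert (K : ccont RtoC l) by apply ccont_RtoC, continuous_id.
  apply ccont_continuous in K.
  specialize (H _ (K P HP)). unfold filtermapi in *. revert H. apply filter_imp.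
  intros [a b] [y [Hy Py]]. exists (RtoC y). split; [| exact Py].
  apply is_RInt_Re_Im; [exact Hy |].
  replace (Im (RtoC y)) with (scal (b - a) 0) by (unfold scal; simpl; unfold mult; simpl; ring).
  apply (is_RInt_const (V := R_NormedModule)).
Qed.

(** With equal weights on both sides, only the difference 2 pi i of the logarithms survives and
    multiplies the integral of [is_RInt_gen_inv_rtail]. *)
Lemma ray_jump (M : nat) (d : R) (Ap Am : C) : 0 < d ->
  is_RInt_gen (V := CV) (fun x => ray_weight M PI x * ray_log PI x)%C
    (at_point d) (Rbar_locally p_infty) Ap ->
  is_RInt_gen (V := CV) (fun x => ray_weight M (- PI) x * ray_log (- PI) x)%C
    (at_point d) (Rbar_locally p_infty) Am ->
  (Ap - Am)%C = (2 * RtoC PI * Ci * RtoC ((-1) ^ S M * (INR (fact M) * (d - ln (rtail M d)))))%C.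
Proof.
  intros Hd Hp Hm.
  pose proof (is_RInt_gen_minus _ _ _ _ Hp Hm) as H1.
  pose proof (is_RInt_gen_Cmult _ _ _ _ (2 * RtoC PI * Ci)%C
    (is_RInt_gen_RtoC _ _ _ _ (is_RInt_gen_scal _ ((-1) ^ S M) _ (is_RInt_gen_inv_rtail M d Hd)))) as H2.
  symmetry. refine (eq_trans (eq_sym (is_RInt_gen_unique (V := CV) _ _ H2)) _).
  apply (is_RInt_gen_unique (V := CV)).
  eapply is_RInt_gen_ext; [| exact H1].
  apply (Filter_prod _ _ _ (fun x => x = d) (fun b => d < b)).
  - reflexivity.
  - now exists d.
  - intros x y -> Hy z Hz. simpl in Hz. rewrite Rmin_left, Rmax_right in Hz by lra.
    rewrite !ray_weight_PI by (auto; lra).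
    set (c := (-1) ^ S M * (z ^ M / rtail M z)).
    change ((RtoC c * ray_log PI z - RtoC c * ray_log (- PI) z)%C
            = (2 * RtoC PI * Ci * RtoC c)%C).
    apply C_eq; simpl; ring.
Qed.

(** * The circle in logarithmic coordinates *)

Lemma ccont_pair {T : UniformSpace} (f g : T -> R) (x : T) :
  continuous f x -> continuous g x -> ccont (fun y => (f y, g y) : C) x.
Proof. intros Hf Hg; split; assumption. Qed.

Lemma cderiv_horizontal (phi r : R) : cderiv (fun x => (x, phi)) r (RtoC 1).
Proof.
  split; simpl; [apply (is_derive_id (K := R_AbsRing)) | apply (is_derive_const (V := R_NormedModule))].
Qed.

Lemma cderiv_vertical (r phi : R) : cderiv (fun x => (r, x)) phi Ci.
Proof.
  split; simpl; [apply (is_derive_const (V := R_NormedModule)) | apply (is_derive_id (K := R_AbsRing))].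
Qed.

Lemma continuity_2d_pt_ccont (F : C -> C) (x y : R) :
  ccont F (x, y) ->
  continuity_2d_pt (fun u v => Re (F (u, v))) x y /\
  continuity_2d_pt (fun u v => Im (F (u, v))) x y.
Proof.
  intros [H1 H2]; split; apply continuity_2d_pt_filterlim.
  - refine (filterlim_ext (fun z => Re (F z)) _ _ H1). now intros [a b].
  - refine (filterlim_ext (fun z => Im (F z)) _ _ H2). now intros [a b].
Qed.

(* The derivative in r of the vertical integral is the integral of dF, and dF integrates
   back to F because i dF is the derivative of F in the vertical direction. *)
Lemma cderiv_vertical_integral (F dF : C -> C) (a b r eta : R) :
  a <= b -> 0 < eta ->
  (forall x t, Rabs (x - r) < eta -> a - 1 <= t <= b + 1 ->
     cderiv (fun y => F (y, t)) x (dF (x, t)) /\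
     cderiv (fun s => F (x, s)) t (Ci * dF (x, t))%C) ->
  (forall t, a <= t <= b -> ccont dF (r, t)) ->
  cderiv (fun x => RInt (V := CV) (fun t => F (x, t)) a b) r (- Ci * (F (r, b) - F (r, a)))%C.
Proof.
  intros Hab He HF HdF.
  assert (EX : forall x, Rabs (x - r) < eta -> ex_RInt (V := CV) (fun t => F (x, t)) a b).
  { intros x Hx. apply ex_RInt_continuous. rewrite Rmin_left, Rmax_right by lra.
    intros t Ht. apply ccont_continuous. eapply cderiv_ccont, (HF x t Hx). lra. }
  assert (L : locally r (fun x => Rabs (x - r) < eta)).
  { exists (mkposreal _ He). intros y Hy. exact Hy. }
  assert (r0 : Rabs (r - r) < eta) by (rewrite Rminus_diag, Rabs_R0; exact He).
  assert (I : is_RInt (V := CV) (fun t => dF (r, t)) a b (- Ci * (F (r, b) - F (r, a)))%C).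
  { replace (- Ci * (F (r, b) - F (r, a)))%C with (- Ci * F (r, b) - - Ci * F (r, a))%C by ring.
    assert (D : forall t, a <= t <= b ->
              cderiv (fun s => - Ci * F (r, s))%C t (dF (r, t))).
    { intros t Ht. eapply cderiv_eq.
      - apply cderiv_mult; [apply cderiv_const | apply (HF r t r0); lra].
      - cbv beta. apply C_eq; unfold Re, Im; simpl; ring. }
    assert (Ct : forall t, a <= t <= b -> ccont (fun s : R_UniformSpace => dF (r, s)) t).
    { intros t Ht. destruct (HdF t Ht) as [C1 C2].
      split; refine (continuous_comp_2 (fun _ => r) (fun s => s)
                       (fun u v => _ (dF (u, v))) t _ _ _);
        try apply continuous_const; try apply continuous_id.
      - refine (continuous_ext (fun z => Re (dF z)) _ _ _ C1). now intros [u v].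
      - refine (continuous_ext (fun z => Im (dF z)) _ _ _ C2). now intros [u v]. }
    apply is_RInt_Re_Im.
    - apply (is_RInt_derive (fun s => Re (- Ci * F (r, s))%C) (fun t => Re (dF (r, t))));
        rewrite Rmin_left, Rmax_right by lra; intros t Ht; [exact (proj1 (D t Ht)) | exact (proj1 (Ct t Ht))].
    - apply (is_RInt_derive (fun s => Im (- Ci * F (r, s))%C) (fun t => Im (dF (r, t))));
        rewrite Rmin_left, Rmax_right by lra; intros t Ht; [exact (proj2 (D t Ht)) | exact (proj2 (Ct t Ht))]. }
  (* Differentiation under the integral needs the r-derivative to be jointly continuous at (r, t)
     even when t is an end of [a, b]; the unit margin in the hypothesis provides the
     neighbourhood. *)
  assert (P2 : forall t, a <= t <= b ->
            locally_2d (fun u v => Rabs (u - r) < eta /\ a - 1 <= v <= b + 1) r t).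
  { intros t Ht. assert (m : 0 < Rmin eta 1) by (apply Rmin_pos; lra).
    exists (mkposreal _ m). simpl. intros u v Hu Hv. split.
    - eapply Rlt_le_trans; [exact Hu | apply Rmin_l].
    - assert (Hv1 : Rabs (v - t) < 1) by (eapply Rlt_le_trans; [exact Hv | apply Rmin_r]).
      apply Rabs_def2 in Hv1. lra. }
  split.
  - apply (is_derive_ext_loc (fun x => RInt (fun t => Re (F (x, t))) a b)).
    + revert L. apply filter_imp. intros x Hx. apply is_RInt_unique.
      apply is_RInt_Re, RInt_correct, EX, Hx.
    + eapply is_derive_eq.
      * apply (is_derive_RInt_param (fun x t => Re (F (x, t))) a b r).
        -- revert L. apply filter_imp. intros x Hx t.
           rewrite Rmin_left, Rmax_right by lra. intros Ht.
           destruct (HF x t Hx ltac:(lra)) as [[D1 D2] _]. eexists. exact D1.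
        -- intros t. rewrite Rmin_left, Rmax_right by lra. intros Ht.
           apply continuity_2d_pt_ext_loc with (fun u v => Re (dF (u, v))).
           ++ generalize (P2 t Ht). apply locally_2d_impl, locally_2d_forall.
              intros u v [Hu Hv]. symmetry. apply is_derive_unique. exact (proj1 (proj1 (HF u v Hu Hv))).
           ++ apply continuity_2d_pt_ccont, HdF, Ht.
        -- revert L. apply filter_imp. intros x Hx. eexists.
           apply is_RInt_Re, RInt_correct, EX, Hx.
      * rewrite <- (is_RInt_unique _ _ _ _ (is_RInt_Re _ _ _ _ I)).
        apply RInt_ext. rewrite Rmin_left, Rmax_right by lra. intros t Ht.
        apply is_derive_unique. exact (proj1 (proj1 (HF r t r0 ltac:(lra)))).
  - apply (is_derive_ext_loc (fun x => RInt (fun t => Im (F (x, t))) a b)).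
    + revert L. apply filter_imp. intros x Hx. apply is_RInt_unique.
      apply is_RInt_Im, RInt_correct, EX, Hx.
    + eapply is_derive_eq.
      * apply (is_derive_RInt_param (fun x t => Im (F (x, t))) a b r).
        -- revert L. apply filter_imp. intros x Hx t.
           rewrite Rmin_left, Rmax_right by lra. intros Ht.
           destruct (HF x t Hx ltac:(lra)) as [[D1 D2] _]. eexists. exact D2.
        -- intros t. rewrite Rmin_left, Rmax_right by lra. intros Ht.
           apply continuity_2d_pt_ext_loc with (fun u v => Im (dF (u, v))).
           ++ generalize (P2 t Ht). apply locally_2d_impl, locally_2d_forall.
              intros u v [Hu Hv]. symmetry. apply is_derive_unique. exact (proj2 (proj1 (HF u v Hu Hv))).
           ++ apply continuity_2d_pt_ccont, HdF, Ht.
        -- revert L. apply filter_imp. intros x Hx. eexists.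
           apply is_RInt_Im, RInt_correct, EX, Hx.
      * rewrite <- (is_RInt_unique _ _ _ _ (is_RInt_Im _ _ _ _ I)).
        apply RInt_ext. rewrite Rmin_left, Rmax_right by lra. intros t Ht.
        apply is_derive_unique. exact (proj2 (proj1 (HF r t r0 ltac:(lra)))).
Qed.

(** * The function w^N / f(w) at w = e^z *)

Definition kernel (M : nat) (z : C) : C :=
  (Cexp (RtoC (INR (S M)) * z) / exp_tail M (Cexp z))%C.

(** The z-derivative of k = w^N / f(w). Since f' = f + w^M / M!, the quotient rule gives the Riccati
    expression N k - w k - k^2 / M!, polynomial in w and k. *)
Definition dkernel (M : nat) (z : C) : C :=
  (RtoC (INR (S M)) * kernel M z - Cexp z * kernel M z
   - kernel M z * kernel M z / RtoC (INR (fact M)))%C.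

Lemma cderiv_kernel (M : nat) (z : R -> C) (t : R) (dz : C) :
  cderiv z t dz -> exp_tail M (Cexp (z t)) <> RtoC 0 ->
  cderiv (fun x => kernel M (z x)) t (dz * dkernel M (z t))%C.
Proof.
  intros Hz H0. eapply cderiv_eq.
  - apply cderiv_mult.
    + apply cderiv_exp, cderiv_mult; [apply cderiv_const | exact Hz].
    + apply cderiv_inv; [apply cderiv_exp_tail, cderiv_exp, Hz | exact H0].
  - cbv beta. unfold dkernel, kernel.
    rewrite !Cexp_INR, Cpow_S. field. split; [exact H0 | apply Cfact_neq_0].
Qed.

Lemma ccont_kernel {T : UniformSpace} (M : nat) (f : T -> C) (x : T) :
  ccont f x -> exp_tail M (Cexp (f x)) <> RtoC 0 -> ccont (fun y => kernel M (f y)) x.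
Proof.
  intros Hf H0. apply ccont_mult.
  - apply ccont_exp, ccont_mult; [apply ccont_const | exact Hf].
  - apply ccont_inv; [now apply ccont_exp_tail, ccont_exp | exact H0].
Qed.

Lemma ccont_dkernel {T : UniformSpace} (M : nat) (f : T -> C) (x : T) :
  ccont f x -> exp_tail M (Cexp (f x)) <> RtoC 0 -> ccont (fun y => dkernel M (f y)) x.
Proof.
  intros Hf H0. pose proof (ccont_kernel M f x Hf H0) as K.
  apply ccont_minus; [apply ccont_minus |].
  - apply ccont_mult; [apply ccont_const | exact K].
  - apply ccont_mult; [now apply ccont_exp | exact K].
  - apply ccont_mult; [now apply ccont_mult | apply ccont_const].
Qed.

Definition log_kernel (M : nat) (z : C) : C := ((z - RtoC PI * Ci) * kernel M z)%C.

Definition dlog_kernel (M : nat) (z : C) : C :=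
  (kernel M z + (z - RtoC PI * Ci) * dkernel M z)%C.

Lemma cderiv_log_kernel (M : nat) (z : R -> C) (t : R) (dz : C) :
  cderiv z t dz -> exp_tail M (Cexp (z t)) <> RtoC 0 ->
  cderiv (fun x => log_kernel M (z x)) t (dz * dlog_kernel M (z t))%C.
Proof.
  intros Hz H0. eapply cderiv_eq.
  - apply cderiv_mult; [apply cderiv_minus; [exact Hz | apply cderiv_const] |].
    eapply cderiv_kernel; eassumption.
  - cbv beta. unfold dlog_kernel.
    generalize (kernel M (z t)) (dkernel M (z t)) (z t). intros. ring.
Qed.

Lemma ccont_dlog_kernel {T : UniformSpace} (M : nat) (f : T -> C) (x : T) :
  ccont f x -> exp_tail M (Cexp (f x)) <> RtoC 0 -> ccont (fun y => dlog_kernel M (f y)) x.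
Proof.
  intros Hf H0. apply ccont_plus; [now apply ccont_kernel |].
  apply ccont_mult; [| now apply ccont_dkernel].
  apply ccont_minus; [exact Hf | apply ccont_const].
Qed.

(** The r-derivative is also taken at r = ln delta, so zero-freeness is needed slightly beyond. On
    the compact segment r = ln delta, |f|^2 has a positive minimum, and uniform continuity keeps it
    positive nearby. The t-interval carries the unit margin of [cderiv_vertical_integral]. *)
Lemma exp_tail_neq_0_enlarge (M : nat) (delta : R) : 0 < delta ->
  (forall w : C, Cmod w <= delta -> exp_tail M w = RtoC 0 -> w = RtoC 0) ->
  exists eta, 0 < eta /\ forall r t, r < ln delta + eta -> - 1 <= t <= 2 * PI + 1 ->
    exp_tail M (Cexp (r, t)) <> RtoC 0.
Proof.
  intros Hd H0. generalize PI_RGT_0; intros HPI.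
  assert (In : forall r t, r <= ln delta -> exp_tail M (Cexp (r, t)) <> RtoC 0).
  { intros r t Hr E. apply (Cexp_neq_0 (r, t)), (H0 _); [| exact E].
    rewrite Cmod_Cexp. simpl. rewrite <- (exp_ln delta Hd). now apply exp_le_compat. }
  set (g := fun t r => fst (exp_tail M (Cexp (r, t))) ^ 2 + snd (exp_tail M (Cexp (r, t))) ^ 2).
  assert (G2 : forall t r, continuity_2d_pt g t r).
  { intros t r. apply continuity_2d_pt_filterlim.
    assert (C0 : ccont (fun p : prod_UniformSpace R_UniformSpace R_UniformSpace =>
                    exp_tail M (Cexp (snd p, fst p))) (t, r)).
    { apply ccont_exp_tail, ccont_exp, ccont_pair; [apply continuous_snd | apply continuous_fst]. }
    exact (ccont_norm_sqr _ _ C0). }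
  destruct (continuity_ab_min (fun t => g t (ln delta)) (- 1) (2 * PI + 1)) as [m [Hm _]].
  - lra.
  - intros c _. apply continuity_pt_filterlim.
    refine (continuous_comp_2 (fun t => t) (fun _ => ln delta) g c _ _ _).
    + apply continuous_id.
    + apply continuous_const.
    + apply continuity_2d_pt_filterlim, G2.
  - assert (Pm : 0 < g m (ln delta)) by (apply Cnorm2_pos, In, Rle_refl).
    destruct (uniform_continuity_2d_1d g (- 1) (2 * PI + 1) (ln delta)
                (fun x _ => G2 x _) (mkposreal _ Pm)) as [[eta He] U].
    simpl in U. exists eta. split; [exact He |]. intros r t Hr Ht.
    destruct (Rle_dec r (ln delta)) as [h | h]; [now apply In |].
    assert (V := U t (ln delta) t r Ht ltac:(lra) Ht ltac:(lra)
                   ltac:(rewrite Rminus_diag, Rabs_R0; exact He)).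
    (* A zero at (r, t) would make [g t (ln delta)] smaller than its minimum over t. *)
    intros E. unfold g at 1 in V. rewrite E in V. simpl fst in V. simpl snd in V.
    specialize (Hm t Ht). apply Rabs_def2 in V. lra.
Qed.

Lemma Cexp_period (r t : R) : Cexp (r, t + 2 * PI) = Cexp (r, t).
Proof.
  unfold Cexp; simpl. now rewrite cos_plus, sin_plus, cos_2PI, sin_2PI, !Rmult_0_r, !Rmult_1_r,
    Rminus_0_r, Rplus_0_r.
Qed.

Definition rkernel (M : nat) (r : R) : R := exp r ^ S M / rtail M (exp r).

Lemma kernel_real (M : nat) (r : R) : kernel M (RtoC r) = RtoC (rkernel M r).
Proof.
  unfold kernel, rkernel. rewrite Cexp_INR, Cexp_RtoC, exp_tail_RtoC, <- RtoC_pow.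
  rewrite RtoC_div; [reflexivity |]. apply Rgt_not_eq, rtail_pos, exp_pos.
Qed.

Definition circle_integral (M : nat) (r : R) : C :=
  RInt (V := CV) (fun t => log_kernel M (r, t)) 0 (2 * PI).

Lemma cderiv_circle_integral (M : nat) (r eta : R) : 0 < eta ->
  (forall x t, x < r + eta -> - 1 <= t <= 2 * PI + 1 -> exp_tail M (Cexp (x, t)) <> RtoC 0) ->
  cderiv (circle_integral M) r (RtoC (2 * PI * rkernel M r)).
Proof.
  intros He H0. generalize PI_RGT_0; intros HPI. eapply cderiv_eq.
  - apply (cderiv_vertical_integral (log_kernel M) (dlog_kernel M) 0 (2 * PI) r eta); auto; [lra | |].
    + intros x t Hx Ht. apply Rabs_def2 in Hx.
      assert (N := H0 x t ltac:(lra) ltac:(lra)). split.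
      * eapply cderiv_eq; [apply cderiv_log_kernel; [apply cderiv_horizontal | exact N] |].
        apply Cmult_1_l.
      * apply cderiv_log_kernel; [apply cderiv_vertical | exact N].
    + intros t Ht. apply (ccont_dlog_kernel M (fun z : C_UniformSpace => z)).
      * split; [apply (continuous_fst (U := R_UniformSpace) (V := R_UniformSpace))
               | apply (continuous_snd (U := R_UniformSpace) (V := R_UniformSpace))].
      * apply H0; lra.
  - unfold log_kernel.
    (* By periodicity of [kernel], the end values of [log_kernel] differ only through z - pi i, that
       is by 2 pi i times the kernel at r. *)
    assert (E : kernel M (r, 2 * PI) = kernel M (RtoC r)).
    { unfold kernel. rewrite !Cexp_INR.
      replace (2 * PI) with (0 + 2 * PI) by ring. now rewrite Cexp_period. }
    change (r, 0) with (RtoC r). rewrite E, kernel_real.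
    apply C_eq; simpl; ring.
Qed.

(** * Asymptotics as r tends to -oo and the value of the circle integral *)

Lemma Cmod_minus_rev (a b : C) : Cmod a - Cmod b <= Cmod (a + b)%C.
Proof.
  generalize (Cmod_triangle (a + b) (- b)). rewrite Cmod_opp.
  replace (a + b + - b)%C with a by ring. lra.
Qed.

(** Write q = N! and f(w) = w^N / q + g(w) with |g| <= e |w|^(N+1) for |w| <= 1. Then w^N / f - q =
    - q g / f, and |f| >= |w|^N / (2 q) once g is at most half the leading term. The bound is
    uniform in Im z, as the integral over t requires. *)
Lemma kernel_asymptotic (M : nat) : exists K c, 0 < c /\ forall z, exp (Re z) <= c ->
  Cmod (kernel M z - RtoC (INR (fact (S M))))%C <= K * exp (Re z).
Proof.
  set (q := INR (fact (S M))). assert (Q : 0 < q) by apply fact_pos.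
  assert (e1 : 0 < exp 1) by apply exp_pos.
  (* The bound on |w| by 1 / (2 q e) forces |g| <= |w|^N / (2 q); then q times e |w|^(N+1) times 2 q
     / |w|^N is 2 q^2 e |w|. *)
  exists (2 * q ^ 2 * exp 1), (Rmin 1 (/ (2 * q * exp 1))).
  assert (I : 0 < / (2 * q * exp 1)) by (apply Rinv_0_lt_compat; nra).
  split; [apply Rmin_pos; lra |].
  intros z Hz. set (r := exp (Re z)) in *. assert (Hr : 0 < r) by apply exp_pos.
  assert (r1 : r <= 1) by (eapply Rle_trans; [exact Hz | apply Rmin_l]).
  assert (r2 : r * exp 1 <= / (2 * q)).
  { apply Rle_trans with (/ (2 * q * exp 1) * exp 1).
    - apply Rmult_le_compat_r; [lra |]. eapply Rle_trans; [exact Hz | apply Rmin_r].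
    - right. field. lra. }
  assert (Pr : 0 < r ^ S M) by now apply pow_lt.
  assert (W : Cmod (Cexp z ^ S M) = r ^ S M) by now rewrite Cmod_pow, Cmod_Cexp.
  assert (T : Cmod (exp_tail (S M) (Cexp z)) <= r ^ S M * (r * exp 1)).
  { eapply Rle_trans; [apply exp_tail_bound |]. rewrite Cmod_Cexp. fold r.
    replace (r ^ S M * (r * exp 1)) with (r ^ S (S M) * exp 1) by (simpl; ring).
    apply Rmult_le_compat_l; [apply pow_le; lra | now apply exp_le_compat]. }
  assert (B : r ^ S M * / (2 * q) <= Cmod (exp_tail M (Cexp z))).
  { rewrite exp_tail_S, Cplus_comm. eapply Rle_trans; [| apply Cmod_minus_rev].
    rewrite Cmod_div by apply Cfact_neq_0. fold q. rewrite W, Cmod_R, Rabs_pos_eq by lra.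
    assert (r ^ S M * (r * exp 1) <= r ^ S M * / (2 * q)) by (apply Rmult_le_compat_l; lra).
    replace (r ^ S M / q) with (2 * (r ^ S M * / (2 * q))) by (field; lra). lra. }
  assert (B0 : 0 < r ^ S M * / (2 * q))
    by (apply Rmult_lt_0_compat; [exact Pr | apply Rinv_0_lt_compat; lra]).
  assert (N : exp_tail M (Cexp z) <> RtoC 0) by (apply Cmod_gt_0; lra).
  replace (kernel M z - RtoC q)%C
    with (- RtoC q * exp_tail (S M) (Cexp z) / exp_tail M (Cexp z))%C.
  2: { unfold kernel. rewrite Cexp_INR. rewrite (exp_tail_S M) in N |- *. fold q in N |- *.
       assert (RtoC q <> RtoC 0) by apply Cfact_neq_0.
       revert N. generalize (exp_tail (S M) (Cexp z)) (Cexp z ^ S M)%C. intros a b N.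
       field. split; [assumption |]. intros E. apply N.
       replace (a + b / RtoC q)%C with ((a * RtoC q + b) / RtoC q)%C by (field; assumption).
       rewrite E. field. assumption. }
  rewrite Cmod_div, Cmod_mult, Cmod_opp, Cmod_R, Rabs_pos_eq by (try exact N; lra).
  apply Rmult_le_reg_r with (Cmod (exp_tail M (Cexp z))); [lra |].
  unfold Rdiv. rewrite Rmult_assoc, Rinv_l, Rmult_1_r by lra.
  apply Rle_trans with (q * (r ^ S M * (r * exp 1))); [apply Rmult_le_compat_l; lra |].
  apply Rle_trans with (2 * q ^ 2 * exp 1 * r * (r ^ S M * / (2 * q))).
  - right. field. lra.
  - apply Rmult_le_compat_l; [| exact B].
    repeat apply Rmult_le_pos; lra.
Qed.

(** The antiderivative of 2 pi [rkernel] normalised by ln N!: as r tends to -oo, N! f(e^r) behaves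
    like e^(N r), so the value is 2 pi M! N r + o(1) with no constant term. *)
Definition circle_value (M : nat) (r : R) : R :=
  2 * PI * INR (fact M) * (ln (INR (fact (S M))) + ln (rtail M (exp r)) - exp r).

Lemma is_derive_circle_value (M : nat) (r : R) :
  is_derive (circle_value M) r (2 * PI * rkernel M r).
Proof.
  pose proof (is_derive_rtail M (exp r)) as D.
  pose proof (rtail_pos M (exp r) (exp_pos r)) as P.
  unfold circle_value, rkernel. auto_derive.
  - split; [eexists; exact D | split; [exact P | auto]].
  - replace (Derive (fun y => rtail M y) (exp r)) with
      (rtail M (exp r) + exp r ^ M / INR (fact M)) by (symmetry; apply is_derive_unique, D).
    simpl pow. field. split; [lra | apply INR_fact_neq_0].
Qed.

Lemma constant_limit_0 (g : R -> R) (b : R) :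
  (forall x, x <= b -> is_derive g x 0) ->
  filterlim g (Rbar_locally m_infty) (locally 0) -> g b = 0.
Proof.
  intros Hd HL.
  apply (filterlim_locally_unique (V := R_NormedModule)
    (F := Rbar_locally m_infty) g); [| exact HL].
  apply (filterlim_ext_loc (fun _ => g b)); [| apply filterlim_const].
  exists b. intros x Hx.
  destruct (MVT_gen g x b (fun _ => 0)) as [c [_ E]].
  - rewrite Rmin_left, Rmax_right by lra. intros y Hy. apply Hd; lra.
  - rewrite Rmin_left, Rmax_right by lra. intros y Hy.
    apply continuity_pt_filterlim, (ex_derive_continuous (V := R_NormedModule)).
    eexists; apply Hd; lra.
  - lra.
Qed.

Lemma circle_integral_correct (M : nat) (r : R) :
  (forall t, 0 <= t <= 2 * PI -> exp_tail M (Cexp (r, t)) <> RtoC 0) ->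
  is_RInt (V := CV) (fun t => log_kernel M (r, t)) 0 (2 * PI) (circle_integral M r).
Proof.
  intros H0. generalize PI_RGT_0; intros HPI.
  apply (RInt_correct (V := CV)), ex_RInt_continuous. rewrite Rmin_left, Rmax_right by lra.
  intros t Ht. apply ccont_continuous. eapply cderiv_ccont.
  apply cderiv_log_kernel; [apply cderiv_vertical | now apply H0].
Qed.

(** Replacing the kernel by its limit N! gives exactly 2 pi N! r. The error is at most 2 pi (pi +
    |r|) K e^r, which tends to 0. *)
Lemma circle_integral_asymptotic (M : nat) (b : R) :
  (forall r t, r <= b -> 0 <= t <= 2 * PI -> exp_tail M (Cexp (r, t)) <> RtoC 0) ->
  filterlim (fun r => Cmod (circle_integral M r - RtoC (2 * PI * INR (fact (S M)) * r))%C)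
    (Rbar_locally m_infty) (locally 0).
Proof.
  intros H0. generalize PI_RGT_0; intros HPI.
  set (q := INR (fact (S M))).
  destruct (kernel_asymptotic M) as [K [c [Hc HK]]]. fold q in HK.
  apply (is_lim_le_le_loc (fun _ => 0) (fun r => 2 * PI * K * (PI * exp r - r * exp r))
             _ m_infty 0).
  (* Below b the integral exists, below 0 one has |r| = - r, and below ln c the kernel estimate
     applies. *)
  - exists (Rmin b (Rmin 0 (ln c))). intros r Hr. split; [apply Cmod_ge_0 |].
    assert (h1 : r < b) by (eapply Rlt_le_trans; [exact Hr | apply Rmin_l]).
    assert (h2 : r < Rmin 0 (ln c)) by (eapply Rlt_le_trans; [exact Hr | apply Rmin_r]).
    assert (h3 : r < 0) by (eapply Rlt_le_trans; [exact h2 | apply Rmin_l]).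
    assert (h4 : r < ln c) by (eapply Rlt_le_trans; [exact h2 | apply Rmin_r]).
    assert (hc : exp r <= c) by (rewrite <- (exp_ln c Hc); apply exp_le_compat; lra).
    assert (I : is_RInt (V := CV) (fun t => (((r, t) : C) - RtoC PI * Ci) * RtoC q)%C 0 (2 * PI)
              (RtoC (2 * PI * q * r))).
    { apply is_RInt_Re_Im.
      - replace (Re (RtoC (2 * PI * q * r))) with (scal (2 * PI - 0) (r * q))
          by (unfold scal; simpl; unfold mult; simpl; ring).
        eapply is_RInt_ext; [| apply (is_RInt_const (V := R_NormedModule))].
        intros t _. simpl. ring.
      (* The antiderivative q (t^2 / 2 - pi t) vanishes at both ends: the branch of log(-w) is
         centred on the circle. *)
      - replace (Im (RtoC (2 * PI * q * r))) with
          (minus (q * (2 * PI * (2 * PI) / 2 - PI * (2 * PI))) (q * (0 * 0 / 2 - PI * 0)))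
          by (unfold minus, plus, opp; simpl; field).
        apply (is_RInt_derive (fun t => q * (t * t / 2 - PI * t))).
        + intros t _. simpl. auto_derive; [auto | field].
        + intros t _. apply (ex_derive_continuous (V := R_NormedModule)). simpl. auto_derive. auto. }
    pose proof (is_RInt_minus _ _ _ _ _ _
      (circle_integral_correct M r (fun t Ht => H0 r t (Rlt_le _ _ h1) Ht)) I) as J.
    replace (2 * PI * K * (PI * exp r - r * exp r))
      with ((2 * PI - 0) * ((PI - r) * (K * exp r))) by ring.
    rewrite <- Cnorm_eq.
    refine (norm_RInt_le_const (V := CV) _ _ _ _ _ _ _ J); [lra |].
    intros t Ht. rewrite Cnorm_eq.
    change (Cmod (log_kernel M (r, t) - ((r, t) - RtoC PI * Ci) * RtoC q)%C
            <= (PI - r) * (K * exp r)).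
    unfold log_kernel.
    replace (_ - _)%C with ((((r, t) : C) - RtoC PI * Ci) * (kernel M (r, t) - RtoC q))%C by ring.
    rewrite Cmod_mult. apply Rmult_le_compat; try apply Cmod_ge_0.
    + eapply Rle_trans; [apply Cmod_le_Re_Im |]. simpl.
      replace (r + - (PI * 0 - 0 * 1)) with r by ring.
      rewrite (Rabs_left r) by lra.
      assert (Rabs (t + - (PI * 1 + 0 * 0)) <= PI) by (apply Rabs_le; lra). lra.
    + apply (HK (r, t)). exact hc.
  - apply is_lim_const.
  - replace (Finite 0) with (Rbar_mult (2 * PI * K) (Finite (PI * 0 - 0)))
      by (simpl; f_equal; ring).
    apply is_lim_scal_l. apply (is_lim_minus' _ _ _ (PI * 0) 0).
    + apply (is_lim_scal_l exp PI m_infty 0), is_lim_exp_m.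
    + apply is_lim_mul_exp_m.
Qed.

Lemma rkernel_asymptotic (M : nat) :
  filterlim (rkernel M) (Rbar_locally m_infty) (locally (INR (fact (S M)))).
Proof.
  destruct (kernel_asymptotic M) as [K [c [Hc HK]]]. set (q := INR (fact (S M))) in *.
  apply (is_lim_le_le_loc (fun r => q - K * exp r) (fun r => q + K * exp r)
             _ m_infty q).
  - exists (ln c). intros r Hr.
    assert (hc : exp (Re (RtoC r)) <= c)
      by (rewrite <- (exp_ln c Hc); apply exp_le_compat; simpl; lra).
    specialize (HK _ hc). rewrite kernel_real, <- RtoC_minus, Cmod_R in HK.
    apply Rabs_le_between in HK. simpl in HK. lra.
  - replace (Finite q) with (Finite (q - K * 0)) by (f_equal; ring).
    apply (is_lim_minus' _ _ _ q (K * 0)); [apply is_lim_const |].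
    apply (is_lim_scal_l exp K m_infty 0), is_lim_exp_m.
  - replace (Finite q) with (Finite (q + K * 0)) by (f_equal; ring).
    apply (is_lim_plus' _ _ _ q (K * 0)); [apply is_lim_const |].
    apply (is_lim_scal_l exp K m_infty 0), is_lim_exp_m.
Qed.

(** Since ln f(e^r) = N r - ln [rkernel] and M! N = N!, the difference is 2 pi M! (ln N! - ln
    [rkernel] - e^r). *)
Lemma circle_value_asymptotic (M : nat) :
  filterlim (fun r => circle_value M r - 2 * PI * INR (fact (S M)) * r)
    (Rbar_locally m_infty) (locally 0).
Proof.
  pose proof (fact_pos (S M)) as Q. set (q := INR (fact (S M))) in *.
  assert (C : continuous (fun y => ln q - ln y) q).
  { apply (ex_derive_continuous (V := R_NormedModule)). auto_derive. auto. }
  unfold continuous in C. rewrite Rminus_diag in C.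
  assert (L1 : is_lim (fun r => ln q - ln (rkernel M r)) m_infty 0)
    by exact (filterlim_comp _ _ _ _ _ _ _ _ (rkernel_asymptotic M) C).
  assert (L2 : is_lim (fun r => 2 * PI * INR (fact M) * (ln q - ln (rkernel M r) - exp r)) m_infty
            (2 * PI * INR (fact M) * (0 - 0))).
  { apply (is_lim_scal_l _ _ m_infty (0 - 0)), (is_lim_minus' _ _ _ 0 0);
      [exact L1 | exact is_lim_exp_m]. }
  rewrite Rminus_diag, Rmult_0_r in L2.
  refine (filterlim_ext _ _ _ L2). intros r. unfold circle_value, rkernel, q.
  pose proof (rtail_pos M (exp r) (exp_pos r)) as P.
  rewrite ln_div, ln_pow, ln_exp by (try apply pow_lt; try apply exp_pos; exact P).
  rewrite (fact_simpl M), mult_INR. ring.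
Qed.

Lemma filterlim_Rabs_le {F : (R -> Prop) -> Prop} {FF : Filter F} (f g : R -> R) :
  (forall x, Rabs (f x) <= g x) -> filterlim g F (locally 0) -> filterlim f F (locally 0).
Proof.
  intros H L. apply filterlim_locally. intros eps.
  generalize (proj1 (filterlim_locally _ _) L eps). apply filter_imp. intros x.
  unfold ball; simpl; unfold AbsRing_ball, abs, minus, plus, opp; simpl.
  rewrite Ropp_0, !Rplus_0_r. apply Rle_lt_trans.
  eapply Rle_trans; [apply H | apply Rle_abs].
Qed.

Lemma circle_integral_value (M : nat) (delta : R) : 0 < delta ->
  (forall w : C, Cmod w <= delta -> exp_tail M w = RtoC 0 -> w = RtoC 0) ->
  is_RInt (V := CV) (fun t => log_kernel M (ln delta, t)) 0 (2 * PI)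
    (RtoC (circle_value M (ln delta))).
Proof.
  intros Hd H0. generalize PI_RGT_0; intros HPI.
  destruct (exp_tail_neq_0_enlarge M delta Hd H0) as [eta [He HN]].
  set (h := fun r => (circle_integral M r - RtoC (circle_value M r))%C).
  assert (D : forall r, r <= ln delta -> cderiv h r (RtoC 0)).
  { intros r Hr. eapply cderiv_eq.
    - apply cderiv_minus.
      + apply (cderiv_circle_integral M r eta He). intros x t Hx. apply HN. lra.
      + apply cderiv_real, is_derive_circle_value.
    - apply C_eq; simpl; ring. }
  assert (L : filterlim (fun r => Cmod (h r)) (Rbar_locally m_infty) (locally 0)).
  { assert (LA : is_lim _ m_infty 0)
      by exact (circle_integral_asymptotic M (ln delta) ltac:(intros; apply HN; lra)).
    assert (N : filterlim Rabs (locally 0) (locally 0)).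
    { rewrite <- Rabs_R0 at 2. apply (filterlim_norm (V := R_NormedModule)). }
    assert (LB : is_lim _ m_infty 0)
      by exact (filterlim_comp _ _ _ _ _ _ _ _ (circle_value_asymptotic M) N).
    cbv beta in LB.
    pose proof (is_lim_plus' _ _ _ _ _ LA LB) as LS. rewrite Rplus_0_r in LS.
    (* Neither function has a finite limit; the triangle inequality passes through their common main
       part 2 pi N! r. *)
    apply (is_lim_le_le_loc (fun _ => 0) _ _ m_infty 0) with (2 := is_lim_const 0 m_infty) (3 := LS).
    exists 0. intros r _. split; [apply Cmod_ge_0 |]. unfold h.
    eapply Rle_trans; [| apply Rplus_le_compat_l; rewrite <- Cmod_R, <- Cmod_opp; apply Rle_refl].
    eapply Rle_trans; [| apply Cmod_triangle]. right. f_equal.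
    rewrite RtoC_minus. ring. }
  assert (LR : filterlim (fun r => Re (h r)) (Rbar_locally m_infty) (locally 0))
    by exact (filterlim_Rabs_le _ _ (fun r => Re_le_Cmod (h r)) L).
  assert (LI : filterlim (fun r => Im (h r)) (Rbar_locally m_infty) (locally 0))
    by exact (filterlim_Rabs_le _ _ (fun r => Im_le_Cmod (h r)) L).
  assert (R0 := constant_limit_0 _ _ (fun r Hr => proj1 (D r Hr)) LR).
  assert (I0 := constant_limit_0 _ _ (fun r Hr => proj2 (D r Hr)) LI).
  assert (E : circle_integral M (ln delta) = RtoC (circle_value M (ln delta))).
  { assert (Z : h (ln delta) = RtoC 0) by (apply C_eq; [exact R0 | exact I0]).
    unfold h in Z.
    replace (circle_integral M (ln delta)) with
      ((circle_integral M (ln delta) - RtoC (circle_value M (ln delta)))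
        + RtoC (circle_value M (ln delta)))%C by ring.
    rewrite Z. ring. }
  rewrite <- E. apply circle_integral_correct. intros t Ht. apply HN; lra.
Qed.

(** * Assembling the contour *)

Lemma integrand_shift (M : nat) (u w l : C) :
  integrand (S M) (RtoC 1 + u) w l
  = (/ exp_tail M w * Cexp (RtoC (INR (S M)) * l) / w * Cexp (u * l))%C.
Proof.
  unfold integrand. replace (S M - 1)%nat with M by lia. fold (exp_tail M w).
  replace ((RtoC 1 + u + RtoC (INR (S M)) - 1) * l)%C
    with (RtoC (INR (S M)) * l + u * l)%C by ring.
  rewrite Cexp_plus. unfold Cdiv. ring.
Qed.

Lemma outgoing_eq (M : nat) (delta : R) (u A : C) :
  is_RInt_gen (V := CV) (fun x => ray_weight M PI x * Cexp (u * ray_log PI x))%C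
    (at_point delta) (Rbar_locally p_infty) A ->
  outgoing (S M) delta (RtoC 1 + u) = A.
Proof.
  intros H. apply (is_RInt_gen_unique (V := CV)).
  eapply is_RInt_gen_ext; [| exact H].
  apply filter_forall. intros p x _. now rewrite integrand_shift.
Qed.

(** This ray is traversed from infinity to delta; exchanging the two filters produces the sign. *)
Lemma incoming_eq (M : nat) (delta : R) (u A : C) :
  is_RInt_gen (V := CV) (fun x => ray_weight M (- PI) x * Cexp (u * ray_log (- PI) x))%C
    (at_point delta) (Rbar_locally p_infty) A ->
  incoming (S M) delta (RtoC 1 + u) = (- A)%C.
Proof.
  intros H. apply (is_RInt_gen_unique (V := CV)).
  refine (is_RInt_gen_swap (V := CV) _ A _).
  eapply is_RInt_gen_ext; [| exact H].
  apply filter_forall. intros p x _. now rewrite integrand_shift.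
Qed.

(** The prescribed value ln delta + i (t - pi) of log(-w), in the form z - pi i of [log_kernel]. *)
Definition circle_log (delta t : R) : C := (((ln delta, t) : C) - RtoC PI * Ci)%C.

(** The factor i comes from dw = i w dt, and the sign from (-w)^N = (-1)^N w^N. *)
Definition circle_weight (M : nat) (delta t : R) : C :=
  (Ci * RtoC ((-1) ^ S M) * kernel M (ln delta, t))%C.

Lemma circle_integrand (M : nat) (delta t : R) (u : C) : 0 < delta ->
  exp_tail M (Cexp (ln delta, t)) <> RtoC 0 ->
  (integrand (S M) (RtoC 1 + u) (RtoC delta * Cexp (Ci * RtoC t)) (ln delta, (t - PI)%R)
     * (Ci * (RtoC delta * Cexp (Ci * RtoC t))))%C
  = (circle_weight M delta t * Cexp (u * circle_log delta t))%C.
Proof.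
  intros Hd H0. rewrite integrand_shift.
  assert (Ew : (RtoC delta * Cexp (Ci * RtoC t))%C = Cexp (ln delta, t)).
  { rewrite <- (exp_ln delta Hd) at 1. rewrite <- Cexp_RtoC, <- Cexp_plus. f_equal.
    apply C_eq; simpl; ring. }
  assert (El : ((ln delta, (t - PI)%R) : C) = circle_log delta t).
  { unfold circle_log. apply C_eq; simpl; ring. }
  assert (Ep : Cexp (circle_log delta t) = (RtoC (- 1) * Cexp (ln delta, t))%C).
  { unfold circle_log, Cminus. rewrite Cexp_plus, Cmult_comm. f_equal.
    unfold Cexp, RtoC, Ci. simpl.
    replace (- (PI * 0 - 0 * 1)) with 0 by ring. replace (- (PI * 1 + 0 * 0)) with (- PI) by ring.
    rewrite exp_0, cos_neg, sin_neg, cos_PI, sin_PI. f_equal; ring. }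
  rewrite Ew, El. unfold circle_weight, kernel. rewrite !Cexp_INR, Ep, Cpow_mult_l, RtoC_pow.
  field. split; [exact H0 | apply Cexp_neq_0].
Qed.

Lemma continuous_Cmod {T : UniformSpace} (f : T -> C) (x : T) :
  ccont f x -> continuous (fun y => Cmod (f y)) x.
Proof.
  intros H. apply (continuous_comp (fun y => fst (f y) ^ 2 + snd (f y) ^ 2) sqrt).
  - now apply ccont_norm_sqr.
  - apply continuity_pt_filterlim, continuity_pt_sqrt. nra.
Qed.

Lemma circle_derivative (M : nat) (delta : R) : 0 < delta ->
  (forall w : C, Cmod w <= delta -> exp_tail M w = RtoC 0 -> w = RtoC 0) ->
  exists (A : C -> C) (K : R),
    (forall u, circle (S M) delta (RtoC 1 + u) = A u) /\
    (forall u, Cmod u <= 1 ->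
      Cmod (A u - A (RtoC 0)
        - u * (Ci * RtoC ((-1) ^ S M) * RtoC (circle_value M (ln delta))))%C <= K * Cmod u ^ 2).
Proof.
  intros Hd H0. generalize PI_RGT_0; intros HPI.
  assert (N : forall t, exp_tail M (Cexp (ln delta, t)) <> RtoC 0).
  { intros t E. apply (Cexp_neq_0 (ln delta, t)), H0; [| exact E].
    rewrite Cmod_Cexp. simpl. rewrite exp_ln by exact Hd. apply Rle_refl. }
  assert (Cz : forall t, ccont (fun y : R_UniformSpace => (ln delta, y) : C) t).
  { intros t. apply ccont_pair; [apply continuous_const | apply continuous_id]. }
  assert (Cl : forall t, ccont (circle_log delta) t).
  { intros t. apply ccont_minus; [apply Cz | apply ccont_const]. }
  assert (Cw : forall t, ccont (circle_weight M delta) t).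
  { intros t. apply ccont_mult; [apply ccont_const | now apply ccont_kernel]. }
  assert (CE : forall u t, ccont (fun y : R_UniformSpace => Cexp (u * circle_log delta y)) t).
  { intros u t. apply ccont_exp, ccont_mult; [apply ccont_const | apply Cl]. }
  set (A := fun u => RInt (V := CV)
    (fun t => circle_weight M delta t * Cexp (u * circle_log delta t))%C 0 (2 * PI)).
  assert (HA : forall u, is_RInt (V := CV)
    (fun t => circle_weight M delta t * Cexp (u * circle_log delta t))%C 0 (2 * PI) (A u)).
  { intros u. apply (RInt_correct (V := CV)), ex_RInt_continuous. intros t _.
    apply ccont_continuous, ccont_mult; [apply Cw | apply CE]. }
  (* On a compact interval the continuous majorant is integrable as it stands, so no explicit
     estimate is made. *)
  set (G := fun t => Cmod (circle_weight M delta t) * exp (2 * Cmod (circle_log delta t))).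
  assert (HG : ex_RInt (V := R_CompleteNormedModule) G 0 (2 * PI)).
  { apply (ex_RInt_continuous (V := R_CompleteNormedModule)). intros t _.
    apply (continuous_mult (K := R_AbsRing)); [apply continuous_Cmod, Cw |].
    apply (continuous_comp (fun y => 2 * Cmod (circle_log delta y)) exp);
      [| apply continuous_exp].
    apply (continuous_mult (K := R_AbsRing)); [apply continuous_const |].
    apply continuous_Cmod, Cl. }
  destruct HG as [lG HG].
  assert (HA1 : is_RInt (V := CV) (fun t => circle_weight M delta t * circle_log delta t)%C
            0 (2 * PI) (Ci * RtoC ((-1) ^ S M) * RtoC (circle_value M (ln delta)))%C).
  { eapply is_RInt_ext; [| apply is_RInt_Cmult, (circle_integral_value M delta Hd H0)].
    intros t _. unfold circle_weight, circle_log, log_kernel. cbv beta.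
    generalize (kernel M (ln delta, t)). intros k.
    match goal with |- ?a = ?b => change (@eq C a b) end. ring. }
  exists A, (2 * lG). split.
  - intros u. apply (is_RInt_unique (V := CV)). eapply is_RInt_ext; [| apply HA].
    intros t _. symmetry. now apply circle_integrand.
  - intros u Hu. replace (2 * lG * Cmod u ^ 2) with (2 * Cmod u ^ 2 * lG) by ring.
    refine (RInt_gen_exp_param (at_point 0) (at_point (2 * PI))
      (circle_weight M delta) (circle_log delta) G lG A _ _ _ _ _ _ u Hu).
    + apply (Filter_prod _ _ _ (fun x => x = 0) (fun x => x = 2 * PI)); try reflexivity.
      intros x y -> ->. simpl. lra.
    + apply filter_forall. intros p x _. apply Rle_refl.
    + now apply is_RInt_gen_at_point.
    + intros v _. apply is_RInt_gen_at_point, HA.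
    + now apply is_RInt_gen_at_point.
Qed.

Theorem theorem3p4 (N : nat) (hN : (1 <= N)%nat) (delta : R)
  (hdelta : 0 < delta)
  (hzero : forall w : C, Cmod w <= delta ->
     (Cexp w - exp_trunc (N - 1) w)%C = RtoC 0 -> w = RtoC 0) :
  @is_derive C_AbsRing C_NormedModule (I_N N delta) (RtoC 1)
    (RtoC ((-1) ^ N * INR (fact (N - 1)) * ln (INR (fact N)))).
Proof.
  destruct N as [|M]; [lia |]. replace (S M - 1)%nat with M in * by lia.
  change (forall w : C, Cmod w <= delta -> exp_tail M w = RtoC 0 -> w = RtoC 0) in hzero.
  generalize PI_RGT_0; intros HPI.
  destruct (ray_derivative M delta PI hdelta) as (Ap & Bp & Kp & Hp & HBp & HKp).
  { rewrite Rabs_pos_eq; lra. }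
  destruct (ray_derivative M delta (- PI) hdelta) as (Am & Bm & Km & Hm & HBm & HKm).
  { rewrite Rabs_Ropp, Rabs_pos_eq; lra. }
  destruct (circle_derivative M delta hdelta hzero) as (Ac & Kc & Hc & HKc).
  set (Bc := (Ci * RtoC ((-1) ^ S M) * RtoC (circle_value M (ln delta)))%C) in HKc.
  assert (PI0 : RtoC PI <> RtoC 0) by (apply RtoC_neq_0; lra).
  assert (Ci0 : Ci <> RtoC 0) by (intros E; apply (f_equal snd) in E; simpl in E; lra).
  set (k := (/ (2 * RtoC PI * Ci))%C).
  assert (E : RtoC ((-1) ^ S M * INR (fact M) * ln (INR (fact (S M))))
              = (k * (- Bm + Bc + Bp))%C).
  { replace (- Bm + Bc + Bp)%C with (Bc + (Bp - Bm))%C by ring.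
    rewrite (ray_jump M delta Bp Bm hdelta HBp HBm). unfold Bc, circle_value, k.
    rewrite exp_ln by exact hdelta.
    rewrite !RtoC_mult, RtoC_minus, RtoC_minus, RtoC_plus. field. auto. }
  rewrite E. apply (is_derive_quadratic _ _ _ (Cmod k * (Km + Kc + Kp))).
  assert (HI : forall u, Cmod u <= 1 ->
            I_N (S M) delta (RtoC 1 + u) = (k * (- Am u + Ac u + Ap u))%C).
  { intros u Hu. unfold I_N. fold k.
    now rewrite (outgoing_eq M delta u _ (Hp u Hu)), (incoming_eq M delta u _ (Hm u Hu)), Hc. }
  intros u Hu.
  replace (I_N (S M) delta (RtoC 1)) with (I_N (S M) delta (RtoC 1 + RtoC 0))
    by now rewrite Cplus_0_r.
  (* Both values of [I_N] are now expressed through the three pieces, so the remainder splits into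
     the three remainders already bounded. *)
  rewrite !HI by (rewrite ?Cmod_0; lra).
  replace (_ - _ - _)%C with (k * (- (Am u - Am (RtoC 0) - u * Bm)
     + (Ac u - Ac (RtoC 0) - u * Bc) + (Ap u - Ap (RtoC 0) - u * Bp)))%C by ring.
  rewrite Cmod_mult, Rmult_assoc. apply Rmult_le_compat_l; [apply Cmod_ge_0 |].
  rewrite !Rmult_plus_distr_r.
  eapply Rle_trans; [apply Cmod_triangle |]. apply Rplus_le_compat; [| now apply HKp].
  eapply Rle_trans; [apply Cmod_triangle |]. apply Rplus_le_compat; [| now apply HKc].
  rewrite Cmod_opp. now apply HKm.
Qed.
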